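(* Let $X=\{x_1,\dots,x_n\}$ be a finite set, $e\notin X$, $k$ a field of characteristic $\neq2$ and $(a_{ij})_{n\times n}$ a non-zero symmetric matrix over $k$. Let $C(n,f)$ be the Clifford dialgebra $$C(n,f)=D(X\cup\{e\}\mid x_i\vdash x_j+x_j\dashv x_i-2a_{ij}e,\ e\vdash y-y,\ y\dashv e-y,\ \ x_i,x_j\in X,\ y\in X\cup\{e\}).$$ Order $X\cup\{e\}$ by $x_1<\dots<x_n<e$, and order the normal diwords in $X\cup\{e\}$ by the deg-lex ordering. Let $S\subset D(X\cup\{e\})$ consist of the following polynomials, where $x_i,x_j\in X$, $y\in X\cup\{e\}$: 1. $x_i\vdash x_j+x_j\dashv x_i-2a_{ij}e$, 2. $e\vdash y-y$, 3. $y\dashv e-y$, 4. $y\dashv x_i\dashv x_j+y\dashv x_j\dashv x_i-2a_{ij}y$ ($i>j$), 5. $y\dashv x_i\dashv x_i-a_{ii}y$, 6. $x_i\vdash x_j\vdash y+x_j\vdash x_i\vdash y-2a_{ij}y$ ($i>j$), 7. $x_i\vdash x_i\vdash y-a_{ii}y$, 8. $x_i\vdash e-e\dashv x_i$. Then: (i) $S$ is a Gröbner–Shirshov basis of $C(n,f)$; that is, $S$ is a Gröbner–Shirshov basis in $D(X\cup\{e\})$ and $S$ generates the same ideal of $D(X\cup\{e\})$ as the defining relations of $C(n,f)$. (ii) A $k$-linear basis of $C(n,f)$ is the set of all elements of the form $\dot y x_{i_1}\cdots x_{i_r}$ (i.e. $y\dashv x_{i_1}\dashv\cdots\dashv x_{i_r}$),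 where $y\in X\cup\{e\}$, $x_{i_j}\in X$, $i_1<i_2<\cdots<i_r$, $r\ge0$.
   Context: Dialgebras. A dialgebra over a field $k$ is a $k$-vector space $D$ with two bilinear associative products $\vdash,\dashv$ such that $a\dashv(b\vdash c)=a\dashv b\dashv c$, $(a\dashv b)\vdash c=a\vdash b\vdash c$, $a\vdash(b\dashv c)=(a\vdash b)\dashv c$ for all $a,b,c$. An ideal is a subspace closed under left and right multiplication by arbitrary elements for both products; $Id(S)$ is the ideal generated by $S$, and $D(Z|S)=D(Z)/Id(S)$, where $D(Z)$ is the free dialgebra on $Z$. Below, $Z$ denotes a well ordered set of generators (here $Z=X\cup\{e\}$). Free dialgebra. $Z^*$ is the free monoid on $Z$. $D(Z)$ has as $k$-basis the set $[Z^*]$ of normal diwords, i.e. nonempty words with one marked letter (the center), $[u]=z_{-m}\cdots z_{-1}\dot{z_0}z_1\cdots z_n$ ($m,n\ge 0$, $z_i\in Z$), which stands for $z_{-m}\vdash\cdots\vdash z_{-1}\vdash z_0\dashv z_1\dashv\cdots\dashv z_n$. $[u]\vdash[v]$ is the concatenation $uv$ with the center of $[v]$, and $[u]\dashv[v]$ is $uv$ with the center of $[u]$. $|[u]|=m+n+1$ is the length. Ordering. $wt([u])=(n+m+1,m,z_{-m},\ldots,z_0,\ldots,z_n)$, and $[u]<[v]$ iff $wt([u])<wt([v])$ lexicographically (deg-lex ordering). For $0\ne f\in D(Z)$, $[\overline f]$ is the largest normal diword occurring in $f$ with nonzero coefficient (the leading term), $\overline f$ its underlying word, and $deg(f)=|[\overline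 f]|$; $f$ is monic if the coefficient of $[\overline f]$ is $1$. A polynomial $f$ is left normed if all normal diwords occurring in it have the form $u\dot z$ (center is the last letter), right normed if all have the form $\dot z u$ (center is the first letter), $u\in Z^*$, $z\in Z$. $s$-diwords. For a nonzero $s\in D(Z)$, an $s$-diword is $[asb]=z_{-m}\vdash\cdots\vdash z_{-1}\vdash z_0\dashv z_1\dashv\cdots\dashv z_n|_{z_p\mapsto s}$ for some $m,n\ge0$, $-m\le p\le n$, $z_i\in Z$, where $a=z_{-m}\cdots z_{p-1}$ and $b=z_{p+1}\cdots z_n$ (possibly empty); the notation $[asb]$ includes the choice of the position $0$ of the center. $[a[\overline s]b]$ denotes the normal diword obtained by the same expression with $s$ replaced by $[\overline s]$. $[asb]$ is a normal $s$-diword if $p=0$, or $p<0$ and $s$ is left normed, or $p>0$ and $s$ is right normed. A normal $s$-diword $[asb]$ is a left (right) normed $s$-diword if both $s$ and the polynomial $[asb]$ are left (right) normed. An $S$-diword is an $s$-diword with $s\in S$. Compositions of monic $f,g\in D(Z)$. (1) If $f$ is not right normed and $z\in Z$, $z\dashv f$ is a composition of left multiplication; if $f$ is not left normed and $z\in Z$, $f\vdash z$ is a composition of right multiplication. (2) Inclusion: if $[w]=[\overline f]=[a[\overline g]b]$ with $[agb]$ a normal $g$-diword, $(f,g)_{[w]}=f-[agb]$. (3) Intersection: if $[w]=[[\overline f]b]=[a[\overline g]]$ with $|\overline f|+|\overline g|>|w|$, $[fb]$ a normal $f$-diword and $[ag]$ a normal $g$-diword, $(f,g)_{[w]}=[fb]-[ag]$.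 Triviality. For a set $S$ of monic polynomials: $z\dashv f$ (resp. $f\vdash z$) is trivial modulo $S$ if it equals a finite sum $\sum\alpha_i[a_is_ib_i]$ with $\alpha_i\in k$, $s_i\in S$, each $[a_is_ib_i]$ a right normed (resp. left normed) $s_i$-diword and $|[a_i[\overline{s_i}]b_i]|\le deg(z\dashv f)$ (resp. $\le deg(f\vdash z)$); the zero composition is trivial (empty sum). $(f,g)_{[w]}$ is trivial modulo $(S,[w])$ if it equals a finite sum $\sum\alpha_i[a_is_ib_i]$ with $\alpha_i\in k$, $s_i\in S$, each $[a_is_ib_i]$ a normal $s_i$-diword with $[a_i[\overline{s_i}]b_i]<[w]$, and moreover each $[a_is_ib_i]$ is a right (left) normed $s_i$-diword whenever both $f$ and $[agb]$ (inclusion case), or both $[fb]$ and $[ag]$ (intersection case), are right (left) normed $S$-diwords. $S$ is a Gröbner–Shirshov basis in $D(Z)$ if all compositions of elements of $S$ are trivial. *)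

(* Defs.v *)
From HB Require Import structures.
From mathcomp Require Import all_boot all_order all_algebra.
From mathcomp Require Import generic_quotient ring_quotient finmap boolp.
From mathcomp.multinomials Require Import monalg.

Set Implicit Arguments.
Unset Strict Implicit.
Unset Printing Implicit Defensive.

Import GRing.Theory.

Local Open Scope ring_scope.

HB.mixin Record Lmodule_isDialgebra (k : fieldType) D of GRing.Lmodule k D := {
  vdash : D -> D -> D;
  dashv : D -> D -> D;
  vdash_linearl : forall c a a' b,
    vdash (c *: a + a') b = c *: vdash a b + vdash a' b;
  vdash_linearr : forall c a b b',
    vdash a (c *: b + b') = c *: vdash a b + vdash a b';
  dashv_linearl : forall c a a' b,
    dashv (c *: a + a') b = c *: dashv a b + dashv a' b;
  dashv_linearr : forall c a b b',
    dashv a (c *: b + b') = c *: dashv a b + dashv a b';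
  vdashA : associative vdash;
  dashvA : associative dashv;
  dashv_vdash : forall a b c, dashv a (vdash b c) = dashv (dashv a b) c;
  vdash_dashv : forall a b c, vdash (dashv a b) c = vdash (vdash a b) c;
  vdash_dashvA : forall a b c, vdash a (dashv b c) = dashv (vdash a b) c
}.

#[short(type="dialgebraType")]
HB.structure Definition Dialgebra (k : fieldType) :=
  {D of Lmodule_isDialgebra k D & GRing.Lmodule k D}.

Notation "a ⊢ b" := (vdash a b) (at level 40, left associativity) : ring_scope.
Notation "a ⊣ b" := (dashv a b) (at level 40, left associativity) : ring_scope.

(* -------------------------------------------------------------------- *)
Section Ideals.
Variables (k : fieldType) (D : dialgebraType k).

Definition is_ideal (I : D -> Prop) : Prop :=
  [/\ I 0, forall c a b, I a -> I b -> I (c *: a + b)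
    & forall a b, I a -> [/\ I (a ⊢ b), I (b ⊢ a), I (a ⊣ b) & I (b ⊣ a)]].

Definition Id (S : D -> Prop) (f : D) : Prop :=
  forall I : D -> Prop, is_ideal I -> (forall s, S s -> I s) -> I f.

Lemma Id_ideal S : is_ideal (Id S).
Proof.
split=> [I []//|c a b ha hb I hI hS|a b ha].
  by case: (hI) => _ h _; apply: h; [apply: ha | apply: hb].
by split=> I hI hS; case: (hI) => _ _ /(_ a b (ha I hI hS)) [].
Qed.

Definition Idb (S : D -> Prop) : D -> bool := fun f => `[< Id S f >].

Lemma IdbP S f : (f \in Idb S) <-> Id S f.
Proof. by split=> /asboolP. Qed.

Lemma Idb_zmod_closed S : zmod_closed (Idb S).
Proof.
have [h0 hl _] := Id_ideal S.
split=> [|a b /IdbP ha /IdbP hb]; apply/IdbP=> //.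
by rewrite addrC -scaleN1r; apply: hl.
Qed.

HB.instance Definition _ S :=
  GRing.isZmodClosed.Build D (Idb S) (Idb_zmod_closed S).

Definition dialg_quot (S : D -> Prop) : Type := 
  Quotient.quot (GRing.ZmodClosed.clone D (Idb S) _).

HB.instance Definition _ S := GRing.Zmodule.on (dialg_quot S).
HB.instance Definition _ S := Quotient.on (dialg_quot S).

Definition quot_pi (S : D -> Prop) (f : D) : dialg_quot S :=
  (\pi_(dialg_quot S) f)%qT.

Section QuotientDialgebra.
Variable S : D -> Prop.
Notation Q := (dialg_quot S).
Notation pi := (quot_pi S).

Lemma quot_piP f g : pi f = pi g <-> Id S (f - g).
Proof.
rewrite -IdbP; have -> : (f - g \in Idb S) = (pi f == pi g).
  exact: (@Quotient.idealrBE D (GRing.ZmodClosed.clone D (Idb S) _)).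
by split=> /eqP.
Qed.

Lemma quot_reprK x : pi (repr x) = x. Proof. exact: reprK. Qed.

Lemma quot_piD f g : pi (f + g) = pi f + pi g.
Proof. exact: (@Quotient.pi_add D (GRing.ZmodClosed.clone D (Idb S) _)). Qed.

Lemma Id_repr f : Id S (repr (pi f) - f).
Proof. by apply/quot_piP; rewrite quot_reprK. Qed.

Definition quot_scale (c : k) (x : Q) : Q := pi (c *: repr x).
Definition quot_vdash (x y : Q) : Q := pi (repr x ⊢ repr y).
Definition quot_dashv (x y : Q) : Q := pi (repr x ⊣ repr y).

Lemma quot_piZ c f : pi (c *: f) = quot_scale c (pi f).
Proof.
apply/esym/quot_piP; rewrite -scalerBr -[_ *: _]addr0.
by have [h0 h _] := Id_ideal S; apply: h => //; apply: Id_repr.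
Qed.

Let vdashBl (a a' b : D) : (a - a') ⊢ b = a ⊢ b - a' ⊢ b.
Proof. by rewrite addrC -scaleN1r vdash_linearl scaleN1r addrC. Qed.
Let vdashBr (a b b' : D) : a ⊢ (b - b') = a ⊢ b - a ⊢ b'.
Proof. by rewrite addrC -scaleN1r vdash_linearr scaleN1r addrC. Qed.
Let dashvBl (a a' b : D) : (a - a') ⊣ b = a ⊣ b - a' ⊣ b.
Proof. by rewrite addrC -scaleN1r dashv_linearl scaleN1r addrC. Qed.
Let dashvBr (a b b' : D) : a ⊣ (b - b') = a ⊣ b - a ⊣ b'.
Proof. by rewrite addrC -scaleN1r dashv_linearr scaleN1r addrC. Qed.

Let IdD f g : Id S f -> Id S g -> Id S (f + g).
Proof.
by move=> hf hg; have [_ h _] := Id_ideal S; rewrite -[f]scale1r; apply: h.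
Qed.

Lemma quot_pi_vdash f g : pi (f ⊢ g) = quot_vdash (pi f) (pi g).
Proof.
have [_ _ h] := Id_ideal S; apply/esym/quot_piP.
rewrite -(subrK (f ⊢ repr (pi g)) (_ ⊢ _)) -addrA -vdashBl -vdashBr.
by apply: IdD; [case: (h _ (repr (pi g)) (Id_repr f))
               | case: (h _ f (Id_repr g))].
Qed.

Lemma quot_pi_dashv f g : pi (f ⊣ g) = quot_dashv (pi f) (pi g).
Proof.
have [_ _ h] := Id_ideal S; apply/esym/quot_piP.
rewrite -(subrK (f ⊣ repr (pi g)) (_ ⊣ _)) -addrA -dashvBl -dashvBr.
by apply: IdD; [case: (h _ (repr (pi g)) (Id_repr f))
               | case: (h _ f (Id_repr g))].
Qed.

Let piE := (quot_piD, quot_piZ, quot_pi_vdash, quot_pi_dashv).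

Fact quot_scaleA c d x : quot_scale c (quot_scale d x) = quot_scale (c * d) x.
Proof. by rewrite -[x]quot_reprK -!piE scalerA. Qed.
Fact quot_scale1 : left_id 1 quot_scale.
Proof. by move=> x; rewrite -[x]quot_reprK -!piE scale1r. Qed.
Fact quot_scaleDr : right_distributive quot_scale +%R.
Proof.
by move=> c x y; rewrite -[x]quot_reprK -[y]quot_reprK -!piE scalerDr.
Qed.
Fact quot_scaleDl x c d : quot_scale (c + d) x = quot_scale c x + quot_scale d x.
Proof. by rewrite -[x]quot_reprK -!piE scalerDl. Qed.

HB.instance Definition _ := GRing.Zmodule_isLmodule.Build k Q
  quot_scaleA quot_scale1 quot_scaleDr quot_scaleDl.

Let piZ c f : pi (c *: f) = c *: pi f. Proof. exact: quot_piZ. Qed.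
Let piE' := (quot_piD, piZ, quot_pi_vdash, quot_pi_dashv).

Fact quot_vdash_linearl c a a' b :
  quot_vdash (c *: a + a') b = c *: quot_vdash a b + quot_vdash a' b.
Proof.
rewrite -[a]quot_reprK -[a']quot_reprK -[b]quot_reprK.
by rewrite -!piE' vdash_linearl.
Qed.
Fact quot_vdash_linearr c a b b' :
  quot_vdash a (c *: b + b') = c *: quot_vdash a b + quot_vdash a b'.
Proof.
rewrite -[a]quot_reprK -[b']quot_reprK -[b]quot_reprK.
by rewrite -!piE' vdash_linearr.
Qed.
Fact quot_dashv_linearl c a a' b :
  quot_dashv (c *: a + a') b = c *: quot_dashv a b + quot_dashv a' b.
Proof.
rewrite -[a]quot_reprK -[a']quot_reprK -[b]quot_reprK.
by rewrite -!piE' dashv_linearl.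
Qed.
Fact quot_dashv_linearr c a b b' :
  quot_dashv a (c *: b + b') = c *: quot_dashv a b + quot_dashv a b'.
Proof.
rewrite -[a]quot_reprK -[b']quot_reprK -[b]quot_reprK.
by rewrite -!piE' dashv_linearr.
Qed.
Fact quot_vdashA : associative quot_vdash.
Proof.
move=> a b c; rewrite -[a]quot_reprK -[b]quot_reprK -[c]quot_reprK.
by rewrite -!piE' vdashA.
Qed.
Fact quot_dashvA : associative quot_dashv.
Proof.
move=> a b c; rewrite -[a]quot_reprK -[b]quot_reprK -[c]quot_reprK.
by rewrite -!piE' dashvA.
Qed.
Fact quot_dashv_vdash a b c :
  quot_dashv a (quot_vdash b c) = quot_dashv (quot_dashv a b) c.
Proof.
rewrite -[a]quot_reprK -[b]quot_reprK -[c]quot_reprK.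
by rewrite -!piE' dashv_vdash.
Qed.
Fact quot_vdash_dashv a b c :
  quot_vdash (quot_dashv a b) c = quot_vdash (quot_vdash a b) c.
Proof.
rewrite -[a]quot_reprK -[b]quot_reprK -[c]quot_reprK.
by rewrite -!piE' vdash_dashv.
Qed.
Fact quot_vdash_dashvA a b c :
  quot_vdash a (quot_dashv b c) = quot_dashv (quot_vdash a b) c.
Proof.
rewrite -[a]quot_reprK -[b]quot_reprK -[c]quot_reprK.
by rewrite -!piE' vdash_dashvA.
Qed.

HB.instance Definition _ := Lmodule_isDialgebra.Build k Q
  quot_vdash_linearl quot_vdash_linearr quot_dashv_linearl quot_dashv_linearr
  quot_vdashA quot_dashvA quot_dashv_vdash quot_vdash_dashv quot_vdash_dashvA.

End QuotientDialgebra.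
End Ideals.

(* -------------------------------------------------------------------- *)
(* The normal diword z_{-m} ... z_{-1} (z_0) z_1 ... z_n is the triple of *)
(* the letters before the center, the center, and the letters after it.   *)
Definition diword (Z : choiceType) : Type := (seq Z * Z * seq Z)%type.

HB.instance Definition _ (Z : choiceType) := Choice.on (diword Z).

Section Diwords.
Variable Z : choiceType.
Implicit Types u v : diword Z.

Definition dpre u : seq Z := u.1.1.
Definition dcenter u : Z := u.1.2.
Definition dpost u : seq Z := u.2.
Definition dword u : seq Z := dpre u ++ dcenter u :: dpost u.
Definition dsize u : nat := size (dword u).

Definition dletter (z : Z) : diword Z := ([::], z, [::]).
Definition dvdash u v : diword Z := (dword u ++ dpre v, dcenter v, dpost v).
Definition ddashv u v : diword Z := (dpre u, dcenter u, dpost u ++ dword v).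

End Diwords.

Definition wt d (Z : orderType d) (u : diword Z) :
    nat *l (nat *l Order.SeqLexiOrder.Exports.seqlexi Z) :=
  (dsize u, (size (dpre u), dword u)).

Definition dle d (Z : orderType d) (u v : diword Z) : bool := (wt u <= wt v)%O.
Definition dlt d (Z : orderType d) (u v : diword Z) : bool := (wt u < wt v)%O.

(* -------------------------------------------------------------------- *)
Definition free_dialgebra (k : fieldType) (Z : choiceType) : Type :=
  {malg k[diword Z]}.

HB.instance Definition _ k Z := GRing.Lmodule.on (free_dialgebra k Z).

Lemma scale_monalgU (k : fieldType) (K : choiceType) (c a : k) (u : K) :
  << c * a *g u >> = c *: << a *g u >> :> {malg k[K]}.
Proof.
by apply/malgP => v; rewrite mcoeffZ (mcoeffU u) (mcoeffU u) -mulrnAr.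
Qed.

Section FreeDialgebra.
Variables (k : fieldType) (Z : choiceType).
Notation D := (free_dialgebra k Z).
Implicit Types (op : diword Z -> diword Z -> diword Z) (f g h : D).

Definition bilin_ext op f g : D :=
  \sum_(u <- msupp f) \sum_(v <- msupp g) << f@_u * g@_v *g op u v >>.

Lemma bilin_extE op f g (A B : {fset diword Z}) :
  (msupp f `<=` A)%fset -> (msupp g `<=` B)%fset ->
  bilin_ext op f g =
    \sum_(u <- A) \sum_(v <- B) << f@_u * g@_v *g op u v >>.
Proof.
move=> fA gB; rewrite /bilin_ext (big_fset_incl _ fA) => [|u _ /mcoeff_outdom ->].
  apply: eq_bigr => u _; apply: big_fset_incl => // v _ /mcoeff_outdom ->.
  by rewrite mulr0 monalgU0.
by rewrite big1 // => v _; rewrite mul0r monalgU0.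
Qed.

Lemma bilin_ext_linearl op c f f' g :
  bilin_ext op (c *: f + f') g = c *: bilin_ext op f g + bilin_ext op f' g.
Proof.
pose A := (msupp f `|` msupp f' `|` msupp (c *: f + f'))%fset.
have A1 : (msupp f `<=` A)%fset by rewrite /A -fsetUA fsubsetUl.
have A2 : (msupp f' `<=` A)%fset by rewrite /A fsetUAC fsubsetUr.
have A3 : (msupp (c *: f + f') `<=` A)%fset by rewrite fsubsetUr.
rewrite !(@bilin_extE _ _ _ A (msupp g)) ?fsubset_refl //.
rewrite scaler_sumr -big_split; apply: eq_bigr => u _ /=.
rewrite scaler_sumr -big_split; apply: eq_bigr => v _ /=.
by rewrite mcoeffD mcoeffZ mulrDl -mulrA monalgUD scale_monalgU.
Qed.

Lemma bilin_ext_linearr op c f g g' :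
  bilin_ext op f (c *: g + g') = c *: bilin_ext op f g + bilin_ext op f g'.
Proof.
pose A := (msupp g `|` msupp g' `|` msupp (c *: g + g'))%fset.
have A1 : (msupp g `<=` A)%fset by rewrite /A -fsetUA fsubsetUl.
have A2 : (msupp g' `<=` A)%fset by rewrite /A fsetUAC fsubsetUr.
have A3 : (msupp (c *: g + g') `<=` A)%fset by rewrite fsubsetUr.
rewrite !(@bilin_extE _ _ _ (msupp f) A) ?fsubset_refl //.
rewrite scaler_sumr -big_split; apply: eq_bigr => u _ /=.
rewrite scaler_sumr -big_split; apply: eq_bigr => v _ /=.
by rewrite mcoeffD mcoeffZ mulrDr mulrCA monalgUD (scale_monalgU c).
Qed.

Lemma bilin_extU op u v :
  bilin_ext op << u >> << v >> = << op u v >>.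
Proof.
rewrite (@bilin_extE _ _ _ [fset u]%fset [fset v]%fset) ?msuppU_le //.
by rewrite !big_seq_fset1 !mcoeffUU mulr1.
Qed.

Lemma linear_eq (F G : D -> D) :
    (forall c f g, F (c *: f + g) = c *: F f + F g) ->
    (forall c f g, G (c *: f + g) = c *: G f + G g) ->
  (forall u, F << u >> = G << u >>) -> F =1 G.
Proof.
move=> linF linG FG f; rewrite [f]monalgE.
elim/big_rec: _ => [|u g _ IH].
  have := linF (-1) 0 0; have := linG (-1) 0 0.
  by rewrite !scaleN1r oppr0 addr0 !addNr => -> ->.
by rewrite -[f@_u]mulr1 scale_monalgU linF linG FG IH.
Qed.

Lemma bilin_ext_assoc op1 op2 op3 op4 f g h :
  (forall u v w, op1 u (op2 v w) = op3 (op4 u v) w) ->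
  bilin_ext op1 f (bilin_ext op2 g h) = bilin_ext op3 (bilin_ext op4 f g) h.
Proof.
move=> opA; move: f; apply: linear_eq => [c f f'|c f f'|u].
- by rewrite bilin_ext_linearl.
- by rewrite !bilin_ext_linearl.
move: g; apply: linear_eq => [c g g'|c g g'|v].
- by rewrite bilin_ext_linearl bilin_ext_linearr.
- by rewrite bilin_ext_linearr bilin_ext_linearl.
move: h; apply: linear_eq => [c h h'|c h h'|w].
- by rewrite !bilin_ext_linearr.
- by rewrite bilin_ext_linearr.
by rewrite !bilin_extU opA.
Qed.

Fact free_vdashA : associative (bilin_ext (@dvdash Z)).
Proof.
move=> f g h; apply: bilin_ext_assoc => u v w.
by rewrite /dvdash /dword /dpre /dpost /dcenter /= -!catA.
Qed.
Fact free_dashvA : associative (bilin_ext (@ddashv Z)).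
Proof.
move=> f g h; apply: bilin_ext_assoc => u v w.
by rewrite /ddashv /dword /dpre /dpost /dcenter /= -!catA.
Qed.
Fact free_dashv_vdash f g h :
  bilin_ext (@ddashv Z) f (bilin_ext (@dvdash Z) g h)
  = bilin_ext (@ddashv Z) (bilin_ext (@ddashv Z) f g) h.
Proof.
apply: bilin_ext_assoc => u v w.
by rewrite /ddashv /dvdash /dword /dpre /dpost /dcenter /= -!catA.
Qed.
Fact free_vdash_dashv f g h :
  bilin_ext (@dvdash Z) (bilin_ext (@ddashv Z) f g) h
  = bilin_ext (@dvdash Z) (bilin_ext (@dvdash Z) f g) h.
Proof.
rewrite -free_vdashA; apply/esym; apply: bilin_ext_assoc => u v w.
by rewrite /ddashv /dvdash /dword /dpre /dpost /dcenter /= -!catA /= -?catA.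
Qed.
Fact free_vdash_dashvA f g h :
  bilin_ext (@dvdash Z) f (bilin_ext (@ddashv Z) g h)
  = bilin_ext (@ddashv Z) (bilin_ext (@dvdash Z) f g) h.
Proof.
apply: bilin_ext_assoc => u v w.
by rewrite /ddashv /dvdash /dword /dpre /dpost /dcenter /= -!catA.
Qed.

HB.instance Definition _ := Lmodule_isDialgebra.Build k D
  (bilin_ext_linearl _) (bilin_ext_linearr _)
  (bilin_ext_linearl _) (bilin_ext_linearr _)
  free_vdashA free_dashvA free_dashv_vdash free_vdash_dashv free_vdash_dashvA.

Definition dmono (u : diword Z) : D := << u >>.
Definition dgen (z : Z) : D := dmono (dletter z).

End FreeDialgebra.

(* -------------------------------------------------------------------- *)
(* The one-hole expressions [asb] that define s-diwords: the hole is the  *)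
(* p-th place of z_{-m} ⊢ ... ⊢ z_{-1} ⊢ z_0 ⊣ z_1 ⊣ ... ⊣ z_n, with      *)
(* p = 0 (HoleCenter), p < 0 (HoleLeft) or p > 0 (HoleRight).             *)
Inductive context (Z : Type) : Type :=
| HoleCenter (a b : seq Z)
    (* [a s b] with a = z_{-m} ... z_{-1} and b = z_1 ... z_n *)
| HoleLeft (a b : seq Z) (z0 : Z) (c : seq Z)
    (* a = z_{-m} ... z_{p-1}, b = z_{p+1} ... z_{-1}, c = z_1 ... z_n *)
| HoleRight (a : seq Z) (z0 : Z) (b c : seq Z).
    (* a = z_{-m} ... z_{-1}, b = z_1 ... z_{p-1}, c = z_{p+1} ... z_n *)

Definition before_hole Z (C : context Z) : seq Z :=
  match C with
  | HoleCenter a _ => a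
  | HoleLeft a _ _ _ => a
  | HoleRight a z0 b _ => a ++ z0 :: b
  end.

Definition after_hole Z (C : context Z) : seq Z :=
  match C with
  | HoleCenter _ b => b
  | HoleLeft _ b z0 c => b ++ z0 :: c
  | HoleRight _ _ _ c => c
  end.

Definition expr T (vd dv : T -> T -> T) (ls : seq T) (c : T) (rs : seq T) : T :=
  foldl dv (foldr vd c ls) rs.

Definition fill Z T (vd dv : T -> T -> T) (gen : Z -> T) (C : context Z) (s : T)
    : T :=
  match C with
  | HoleCenter a b => expr vd dv (map gen a) s (map gen b)
  | HoleLeft a b z0 c =>
      expr vd dv (map gen a ++ s :: map gen b) (gen z0) (map gen c)
  | HoleRight a z0 b c =>
      expr vd dv (map gen a) (gen z0) (map gen b ++ s :: map gen c)
  end.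

Definition fill_diword (Z : choiceType) (C : context Z) (u : diword Z) :=
  fill (@dvdash Z) (@ddashv Z) (@dletter Z) C u.

Definition fill_poly (k : fieldType) (Z : choiceType) (C : context Z)
    (s : free_dialgebra k Z) : free_dialgebra k Z :=
  fill (@vdash k _) (@dashv k _) (@dgen k Z) C s.

Section Coherence.
Variables (k : fieldType) (Z : choiceType).
Notation D := (free_dialgebra k Z).
Implicit Types u v : diword Z.

Lemma vdashU u v : dmono k u ⊢ dmono k v = dmono k (dvdash u v).
Proof. exact: bilin_extU. Qed.
Lemma dashvU u v : dmono k u ⊣ dmono k v = dmono k (ddashv u v).
Proof. exact: bilin_extU. Qed.

Lemma expr_monomial (ls rs : seq (diword Z)) u :
  expr (@vdash k D) (@dashv k D) [seq dmono k v | v <- ls] (dmono k u)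
    [seq dmono k v | v <- rs]
  = dmono k (expr (@dvdash Z) (@ddashv Z) ls u rs).
Proof.
rewrite /expr; have -> : foldr (@vdash k D) (dmono k u) [seq dmono k v | v <- ls]
    = dmono k (foldr (@dvdash Z) u ls).
  by elim: ls => [//|v ls] /= ->; apply: vdashU.
elim: rs (foldr _ _ _) => [//|v rs IH w] /=.
by rewrite -IH; congr foldl; apply: dashvU.
Qed.

Lemma diwordE (u : diword Z) :
  dmono k u = expr (@vdash k D) (@dashv k D)
    [seq dgen k z | z <- dpre u] (dgen k (dcenter u))
    [seq dgen k z | z <- dpost u].
Proof.
have mapE s : [seq dgen k z | z <- s] =
    [seq dmono k v | v <- map (@dletter Z) s] by rewrite -map_comp.
rewrite !mapE expr_monomial /expr; case: u => [[a z] b] /=.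
congr dmono; rewrite /dpre /dcenter /dpost /=.
have -> : foldr (@dvdash Z) (dletter z) (map (@dletter Z) a) = (a, z, [::]).
  by elim: a => //= y a ->.
rewrite -[b in LHS]/([::] ++ b); elim: b [::] => [|y b IH] c /=.
  by rewrite cats0.
by rewrite -cat_rcons IH /ddashv /= cats1.
Qed.

Lemma fill_poly_monomial (C : context Z) u :
  fill_poly C (dmono k u) = dmono k (fill_diword C u).
Proof.
have mapE s : [seq dgen k z | z <- s] =
    [seq dmono k v | v <- map (@dletter Z) s] by rewrite -map_comp.
case: C => [a b|a b z c|a z b c]; rewrite /fill_poly /fill_diword /= !mapE;
  rewrite -expr_monomial ?map_cat //=.
Qed.

End Coherence.

(* -------------------------------------------------------------------- *)
(* The order on Z is meant to be a well-order; the definitions only use   *)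
(* that it is total, and every order on a finite Z is a well-order.       *)
Section GroebnerShirshov.
Variables (k : fieldType) (d : Order.disp_t) (Z : orderType d).
Notation D := (free_dialgebra k Z).
Implicit Types (f g h s : D) (u v w : diword Z) (C : context Z).

Definition leading f u : Prop :=
  u \in msupp f /\ forall v, v \in msupp f -> dle v u.

Definition monic f : Prop := exists2 u, leading f u & f@_u = 1.

Definition left_normed f : Prop := forall u, u \in msupp f -> dpost u = [::].
Definition right_normed f : Prop := forall u, u \in msupp f -> dpre u = [::].

Definition normal_sdiword C s : Prop :=
  match C with
  | HoleCenter _ _ => True
  | HoleLeft _ _ _ _ => left_normed s
  | HoleRight _ _ _ _ => right_normed s
  end.

Definition left_normed_sdiword C s : Prop :=
  [/\ normal_sdiword C s, left_normed s & left_normed (fill_poly C s)].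

Definition right_normed_sdiword C s : Prop :=
  [/\ normal_sdiword C s, right_normed s & right_normed (fill_poly C s)].

Variable S : D -> Prop.

Definition combination (P : context Z -> D -> Prop) h : Prop :=
  exists (N : nat) (alpha : 'I_N -> k) (C : 'I_N -> context Z) (s : 'I_N -> D),
    (forall i, S (s i) /\ P (C i) (s i)) /\
    h = \sum_i alpha i *: fill_poly (C i) (s i).

(* For h = 0 the bound on the length is void, and the empty sum is        *)
(* available anyway.                                                      *)
Definition bounded_by h C s : Prop :=
  exists2 u, leading s u &
    forall w, leading h w -> (dsize (fill_diword C u) <= dsize w)%N.

Definition trivial_left_mult h : Prop :=
  combination (fun C s => right_normed_sdiword C s /\ bounded_by h C s) h.

Definition trivial_right_mult h : Prop :=
  combination (fun C s => left_normed_sdiword C s /\ bounded_by h C s) h.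

Definition trivial_mod w (rn ln : Prop) h : Prop :=
  combination (fun C s =>
    [/\ normal_sdiword C s,
        exists2 u, leading s u & dlt (fill_diword C u) w,
        rn -> right_normed_sdiword C s
      & ln -> left_normed_sdiword C s]) h.

Definition left_mult_trivial : Prop :=
  forall f (z : Z), S f -> ~ right_normed f -> trivial_left_mult (dgen k z ⊣ f).

Definition right_mult_trivial : Prop :=
  forall f (z : Z), S f -> ~ left_normed f -> trivial_right_mult (f ⊢ dgen k z).

Definition inclusion_trivial : Prop :=
  forall f g C u v, S f -> S g -> leading f u -> leading g v ->
    normal_sdiword C g -> u = fill_diword C v ->
    trivial_mod u (right_normed f /\ right_normed_sdiword C g)
      (left_normed f /\ left_normed_sdiword C g) (f - fill_poly C g).

Definition intersection_trivial : Prop :=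
  forall f g Cf Cg u v w, S f -> S g -> leading f u -> leading g v ->
    before_hole Cf = [::] -> after_hole Cg = [::] ->
    normal_sdiword Cf f -> normal_sdiword Cg g ->
    w = fill_diword Cf u -> w = fill_diword Cg v ->
    (dsize u + dsize v > dsize w)%N ->
    trivial_mod w (right_normed_sdiword Cf f /\ right_normed_sdiword Cg g)
      (left_normed_sdiword Cf f /\ left_normed_sdiword Cg g)
      (fill_poly Cf f - fill_poly Cg g).

Definition is_GS_basis : Prop :=
  [/\ forall s, S s -> monic s, left_mult_trivial, right_mult_trivial,
      inclusion_trivial & intersection_trivial].

End GroebnerShirshov.

(* -------------------------------------------------------------------- *)
Definition linear_basis (k : fieldType) (V : lmodType k) (I : choiceType)
    (b : I -> V) : Prop :=
  (forall c : {malg k[I]}, \sum_(i <- msupp c) c@_i *: b i = 0 -> c = 0) /\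
  (forall v, exists c : {malg k[I]}, v = \sum_(i <- msupp c) c@_i *: b i).

(* -------------------------------------------------------------------- *)
Section Clifford.
Variables (k : fieldType) (n : nat) (A : 'M[k]_n).

(* X ∪ {e} is 'I_n.+1: x_1, ..., x_n are 0, ..., n-1 and e is n, so that  *)
(* the order x_1 < ... < x_n < e is the usual one.                        *)
Notation Z := 'I_n.+1.
Definition xletter (i : 'I_n) : Z := widen_ord (leqnSn n) i.
Definition eletter : Z := ord_max.

Notation D := (free_dialgebra k Z).
Notation x i := (dgen k (xletter i)).
Notation e := (dgen k eletter).
Notation gen y := (dgen k y).

Inductive clifford_relation : D -> Prop :=
| CliffordRel (i j : 'I_n) :
    clifford_relation (x i ⊢ x j + x j ⊣ x i - (2%:R * A i j) *: e)
| CliffordBarL (y : Z) : clifford_relation (e ⊢ gen y - gen y)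
| CliffordBarR (y : Z) : clifford_relation (gen y ⊣ e - gen y).

Inductive clifford_GS : D -> Prop :=
| CliffordGS1 (i j : 'I_n) :
    clifford_GS (x i ⊢ x j + x j ⊣ x i - (2%:R * A i j) *: e)
| CliffordGS2 (y : Z) : clifford_GS (e ⊢ gen y - gen y)
| CliffordGS3 (y : Z) : clifford_GS (gen y ⊣ e - gen y)
| CliffordGS4 (i j : 'I_n) (y : Z) : (j < i)%N ->
    clifford_GS (gen y ⊣ x i ⊣ x j + gen y ⊣ x j ⊣ x i - (2%:R * A i j) *: gen y)
| CliffordGS5 (i : 'I_n) (y : Z) :
    clifford_GS (gen y ⊣ x i ⊣ x i - A i i *: gen y)
| CliffordGS6 (i j : 'I_n) (y : Z) : (j < i)%N ->
    clifford_GS (x i ⊢ x j ⊢ gen y + x j ⊢ x i ⊢ gen y - (2%:R * A i j) *: gen y)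
| CliffordGS7 (i : 'I_n) (y : Z) :
    clifford_GS (x i ⊢ x i ⊢ gen y - A i i *: gen y)
| CliffordGS8 (i : 'I_n) : clifford_GS (x i ⊢ e - e ⊣ x i).

Definition clifford : dialgebraType k := dialg_quot clifford_relation.

Definition clifford_gen (z : Z) : clifford :=
  quot_pi clifford_relation (dgen k z).

Definition increasing_seq : Type :=
  {s : seq 'I_n | sorted (fun i j : 'I_n => (i < j)%N) s}.

HB.instance Definition _ := Choice.on increasing_seq.

Definition clifford_monomial (p : Z * increasing_seq) : clifford :=
  foldl (@dashv k clifford) (clifford_gen p.1)
    [seq clifford_gen (xletter i) | i <- val p.2].

End Clifford.

(* Main.v *)
(* All compositions are treated at once. A composition lies in Id(S) and its  *)
(* diwords are smaller than [w], so reducing it by normal S-diwords writes it *)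
(* as an admissible combination plus a combination of irreducible diwords;    *)
(* the remainder vanishes because the irreducible diwords are linearly        *)
(* independent modulo Id(S). Independence is read off a model: with Cl the    *)
(* Clifford algebra and V = k(X ∪ {e}), the space V ⊗ Cl carries commuting    *)
(* left and right actions of the letters, and evaluating                      *)
(*   y_1 ... y_m (z) t_1 ... t_l  |->  y_1 ... y_m . (z ⊗ 1) . t_1 ... t_l    *)
(* kills Id(S) and sends the irreducible diwords to a basis. The triviality   *)
(* conditions on right (left) normed compositions are met by running the same *)
(* reduction with right (left) normed S-diwords only; for the left normed one *)
(* the irreducible diwords change, and so does the model.                     *)
From HB Require Import structures.
Require Import Defs.
From mathcomp Require Import all_boot all_order all_algebra.
From mathcomp Require Import finmap boolp ring zify ssrAC.
From mathcomp.multinomials Require Import monalg.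

Set Implicit Arguments.
Unset Strict Implicit.
Unset Printing Implicit Defensive.

Import Order.TTheory GRing.Theory.
Local Open Scope ring_scope.

(** * Linear extensions and actions on diwords *)

(** Equality of ideals: multiplying relation 1 by [y ⊣] on the left or by [⊢ y] on the right gives 4
    and 6, and their cases i = j, divided by 2, give 5 and 7. Relation 8 needs a nonzero entry of
    the matrix: [derived8_aux] compares the defects x_i ⊢ e - e ⊣ x_i for different i and forces
    them all to vanish ([derived8]).

    Gröbner-Shirshov property: no composition is computed by hand. Deg-lex on a finite alphabet is a
    well-order ([dlt_wf]), so every polynomial reduces to irreducible diwords ([reducesI]), and a
    linear map that kills the S-diwords used and is injective on irreducible combinations shows that
    the remainder of anything it kills is 0 ([reduces_to_zero]). The map is evaluation at the
    generators in a bimodule with commuting actions ([annihilated_ideal]), built from the Clifford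
    algebra realized on the exterior algebra ([gamma_anticomm]). [bimod_eval] serves the normal and
    the right normed cases, [free_eval] the left normed one.

    Linear basis: the irreducible diwords span the quotient by reduction and have distinct basis
    vectors of the model as images. *)

Section LinearExtension.
Variables (k : fieldType) (K : choiceType) (V : lmodType k).
Implicit Types (b : K -> V) (f g : {malg k[K]}).

Definition linext b f : V := \sum_(i <- msupp f) f@_i *: b i.

Lemma linextE b f (A : {fset K}) :
  (msupp f `<=` A)%fset -> linext b f = \sum_(i <- A) f@_i *: b i.
Proof.
move=> fA; rewrite /linext; apply: big_fset_incl => // i _ /mcoeff_outdom ->.
by rewrite scale0r.
Qed.

Lemma linext_is_linear b : linear (linext b).
Proof.
move=> c f g; pose A := (msupp f `|` msupp g `|` msupp (c *: f + g))%fset.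
have fA : (msupp f `<=` A)%fset by rewrite /A -fsetUA fsubsetUl.
have gA : (msupp g `<=` A)%fset by rewrite /A fsetUAC fsubsetUr.
have fgA : (msupp (c *: f + g) `<=` A)%fset by rewrite fsubsetUr.
rewrite !(@linextE b _ A) // scaler_sumr -big_split; apply: eq_bigr => i _ /=.
by rewrite mcoeffD mcoeffZ scalerDl scalerA.
Qed.

HB.instance Definition _ b :=
  GRing.isLinear.Build k {malg k[K]} V *:%R (linext b) (linext_is_linear b).

Lemma linextU b c i : linext b << c *g i >> = c *: b i.
Proof.
by rewrite (@linextE _ _ [fset i]%fset) ?msuppU_le // big_seq_fset1 mcoeffUU.
Qed.

End LinearExtension.

(** * Evaluation of the free dialgebra in a bimodule *)

Section Representation.
Variables (k : fieldType) (Z : choiceType) (M : lmodType k).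
Notation D := (free_dialgebra k Z).
Variables (L R : Z -> {linear M -> M}) (m0 : Z -> M).
Hypothesis LR : forall y z m, L y (R z m) = R z (L y m).
Implicit Types (f g : D) (m : M) (u v : diword Z).

Definition lop (s : seq Z) m : M := foldr (fun z => L z) m s.
Definition rop (s : seq Z) m : M := foldl (fun m z => R z m) m s.

Fact lop_is_linear s : linear (lop s).
Proof. by elim: s => [//|z s IH] c m m' /=; rewrite IH linearP. Qed.
HB.instance Definition _ s :=
  GRing.isLinear.Build k M M *:%R (lop s) (lop_is_linear s).

Fact rop_is_linear s : linear (rop s).
Proof. by elim: s => [//|z s IH] c m m' /=; rewrite -IH linearP. Qed.
HB.instance Definition _ s :=
  GRing.isLinear.Build k M M *:%R (rop s) (rop_is_linear s).

Lemma lop_cat s t m : lop (s ++ t) m = lop s (lop t m).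
Proof. exact: foldr_cat. Qed.
Lemma rop_cat s t m : rop (s ++ t) m = rop t (rop s m).
Proof. exact: foldl_cat. Qed.
Lemma lop_rop s t m : lop s (rop t m) = rop t (lop s m).
Proof.
elim: t m => [//|z t IH] m /=; rewrite IH; congr rop.
by elim: s {IH} => [//|y s IH] /=; rewrite IH LR.
Qed.

(** The actions forget the center: on the bar side of a product, ⊢ and ⊣ agree in every dialgebra,
    so both products act by composition. Only [eval] sees where the center is. *)
Definition lact f m : M := linext (fun u => lop (dword u) m) f.
Definition ract f m : M := linext (fun u => rop (dword u) m) f.
Definition point u : M := lop (dpre u) (rop (dpost u) (m0 (dcenter u))).
Definition eval f : M := linext point f.

Lemma lactU u m : lact (dmono k u) m = lop (dword u) m.
Proof. by rewrite /lact linextU scale1r. Qed.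
Lemma ractU u m : ract (dmono k u) m = rop (dword u) m.
Proof. by rewrite /ract linextU scale1r. Qed.
Lemma evalU u : eval (dmono k u) = point u.
Proof. by rewrite /eval linextU scale1r. Qed.

Lemma linext_bilin (V : lmodType k) op (P Q : diword Z -> V)
    (G : diword Z -> {linear V -> V}) f g :
    (forall u v, P (op u v) = G u (Q v)) ->
  linext P (bilin_ext op f g) = linext (fun u => G u (linext Q g)) f.
Proof.
move=> PG; rewrite /bilin_ext linear_sum; apply: eq_bigr => u _ /=.
rewrite linear_sum /linext linear_sum scaler_sumr; apply: eq_bigr => v _ /=.
by rewrite [LHS]linextU PG linearZ scalerA.
Qed.

Lemma linext_bilinC (V : lmodType k) op (P Q : diword Z -> V)
    (G : diword Z -> {linear V -> V}) f g :
    (forall u v, P (op u v) = G v (Q u)) ->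
  linext P (bilin_ext op f g) = linext (fun v => G v (linext Q f)) g.
Proof.
move=> PG; rewrite /bilin_ext linear_sum.
under eq_bigr => u _ do rewrite linear_sum.
rewrite exchange_big /=; apply: eq_bigr => v _ /=.
rewrite /linext linear_sum scaler_sumr; apply: eq_bigr => u _ /=.
by rewrite [LHS]linextU PG linearZ scalerA mulrC.
Qed.

Lemma lact_vdash f g m : lact (f ⊢ g) m = lact f (lact g m).
Proof.
apply: linext_bilin => u v /=; rewrite -lop_cat.
by rewrite /dvdash /dword /dpre /= -catA.
Qed.
Lemma lact_dashv f g m : lact (f ⊣ g) m = lact f (lact g m).
Proof.
apply: linext_bilin => u v /=; rewrite -lop_cat.
by rewrite /ddashv /dword /dpre /= -catA.
Qed.
Lemma ract_vdash f g m : ract (f ⊢ g) m = ract g (ract f m).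
Proof.
apply: linext_bilinC => u v /=; rewrite -rop_cat.
by rewrite /dvdash /dword /dpre /= -catA.
Qed.
Lemma ract_dashv f g m : ract (f ⊣ g) m = ract g (ract f m).
Proof.
apply: linext_bilinC => u v /=; rewrite -rop_cat.
by rewrite /ddashv /dword /dpre /= -catA.
Qed.
Lemma eval_vdash f g : eval (f ⊢ g) = lact f (eval g).
Proof.
by apply: linext_bilin => u v /=; rewrite /point /dvdash /dpre /= lop_cat.
Qed.
Lemma eval_dashv f g : eval (f ⊣ g) = ract g (eval f).
Proof.
apply: linext_bilinC => u v /=.
by rewrite /point /ddashv /dpre /dpost /= rop_cat lop_rop.
Qed.

(** The kernel of [eval] alone is not visibly an ideal: f enters f ⊢ g through [lact f] and g ⊣ f
    through [ract f]. Asking for all three makes the condition stable under both products. *)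
Definition annihilated f : Prop :=
  [/\ forall m, lact f m = 0, forall m, ract f m = 0 & eval f = 0].

Fact lact_linearr f c m m' : lact f (c *: m + m') = c *: lact f m + lact f m'.
Proof.
rewrite /lact /linext scaler_sumr -big_split; apply: eq_bigr => u _ /=.
by rewrite linearP scalerDr !scalerA mulrC.
Qed.
Fact ract_linearr f c m m' : ract f (c *: m + m') = c *: ract f m + ract f m'.
Proof.
rewrite /ract /linext scaler_sumr -big_split; apply: eq_bigr => u _ /=.
by rewrite linearP scalerDr !scalerA mulrC.
Qed.
HB.instance Definition _ f :=
  GRing.isLinear.Build k M M *:%R (lact f) (lact_linearr f).
HB.instance Definition _ f :=
  GRing.isLinear.Build k M M *:%R (ract f) (ract_linearr f).

Lemma lactP c f g m : lact (c *: f + g) m = c *: lact f m + lact g m.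
Proof. exact: (linext_is_linear (fun u => lop (dword u) m) c f g). Qed.
Lemma ractP c f g m : ract (c *: f + g) m = c *: ract f m + ract g m.
Proof. exact: (linext_is_linear (fun u => rop (dword u) m) c f g). Qed.
Lemma evalP c f g : eval (c *: f + g) = c *: eval f + eval g.
Proof. exact: (linext_is_linear point c f g). Qed.

HB.instance Definition _ := GRing.isLinear.Build k D M *:%R eval evalP.

Lemma lactD f g m : lact (f + g) m = lact f m + lact g m.
Proof. by have := lactP 1 f g m; rewrite !scale1r. Qed.
Lemma lactB f g m : lact (f - g) m = lact f m - lact g m.
Proof. by rewrite addrC; have := lactP (-1) g f m; rewrite !scaleN1r addrC => ->; rewrite addrC. Qed.
Lemma lactZ c f m : lact (c *: f) m = c *: lact f m.
Proof. exact: (linearZ_LR (linext _)). Qed.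
Lemma ractD f g m : ract (f + g) m = ract f m + ract g m.
Proof. by have := ractP 1 f g m; rewrite !scale1r. Qed.
Lemma ractB f g m : ract (f - g) m = ract f m - ract g m.
Proof. by rewrite addrC; have := ractP (-1) g f m; rewrite !scaleN1r addrC => ->; rewrite addrC. Qed.
Lemma ractZ c f m : ract (c *: f) m = c *: ract f m.
Proof. exact: (linearZ_LR (linext _)). Qed.
Lemma evalD f g : eval (f + g) = eval f + eval g.
Proof. by have := evalP 1 f g; rewrite !scale1r. Qed.
Lemma evalB f g : eval (f - g) = eval f - eval g.
Proof. by rewrite addrC; have := evalP (-1) g f; rewrite !scaleN1r addrC => ->; rewrite addrC. Qed.
Lemma evalZ c f : eval (c *: f) = c *: eval f.
Proof. exact: (linearZ_LR (linext _)). Qed.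

Lemma lact_gen z m : lact (dgen k z) m = L z m.
Proof. exact: lactU. Qed.
Lemma ract_gen z m : ract (dgen k z) m = R z m.
Proof. exact: ractU. Qed.
Lemma eval_gen z : eval (dgen k z) = m0 z.
Proof. exact: evalU. Qed.

Lemma annihilated_ideal : is_ideal annihilated.
Proof.
split=> [|c f g [lf rf vf] [lg rg vg]|f g [lf rf vf]].
- by split=> [m|m|]; apply: linear0.
- split=> [m|m|].
  + by rewrite lactP lf lg scaler0 addr0.
  + by rewrite ractP rf rg scaler0 addr0.
  + by rewrite evalP vf vg scaler0 addr0.
split; split=> [m|m|].
all: by rewrite ?(lact_vdash, lact_dashv, ract_vdash, ract_dashv,
  eval_vdash, eval_dashv) ?(lf, rf, vf) // linear0.
Qed.

End Representation.

(** * The Clifford algebra *)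

Section CliffordOperators.
Variables (k : fieldType) (n : nat).
Implicit Types (i j l : 'I_n) (I J : {set 'I_n}) (u v : bool -> 'I_n -> k).
Notation W := {ffun {set 'I_n} -> k^o}.
Implicit Types (f : W).

(** Symmetric difference with {i}. In the exterior algebra, [sgn i I] is the sign of moving x_i past
    the factors of x_I with smaller index. *)
Definition toggle i I : {set 'I_n} := [set j | (j \in I) (+) (j == i)].
Definition sgn i I : k := \prod_(l : 'I_n | (l < i)%N) (-1) ^+ (l \in I).
Definition parity I : k := \prod_l (-1) ^+ (l \in I).

(* On k^{subsets of X} = Λ(k^n), with f I the coefficient of x_I, gamma u *)
(* is exterior multiplication by the vector u true plus contraction with  *)
(* the covector u false.                                                  *)
Definition gamma u f : W :=
  [ffun I : {set 'I_n} => \sum_j u (j \in I) j * sgn j I * f (toggle j I)].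
Definition grading f : W := [ffun I : {set 'I_n} => parity I * f I].
Definition delta I : W := [ffun J : {set 'I_n} => (J == I)%:R].

Fact gamma_is_linear u : linear (gamma u).
Proof.
move=> c f g; apply/ffunP => I; rewrite !ffunE scaler_sumr -big_split.
apply: eq_bigr => j _; rewrite !ffunE mulrDr; congr (_ + _).
by rewrite [c *: f _]/(c * _) mulrCA.
Qed.
HB.instance Definition _ u :=
  GRing.isLinear.Build k W W *:%R (gamma u) (gamma_is_linear u).

Fact grading_is_linear : linear grading.
Proof.
move=> c f g; apply/ffunP => I; rewrite !ffunE mulrDr; congr (_ + _).
by rewrite [c *: f _]/(c * _) mulrCA.
Qed.
HB.instance Definition _ :=
  GRing.isLinear.Build k W W *:%R grading grading_is_linear.

Lemma in_toggle i j I : (j \in toggle i I) = (j \in I) (+) (j == i).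
Proof. by rewrite inE. Qed.

Lemma toggleC i j I : toggle i (toggle j I) = toggle j (toggle i I).
Proof. by apply/setP => l; rewrite !in_toggle addbAC. Qed.

Lemma toggleK i : involutive (toggle i).
Proof. by move=> I; apply/setP => l; rewrite !in_toggle -addbA addbb addbF. Qed.

Lemma sgn_toggle i j I : sgn i (toggle j I) = (-1) ^+ (j < i)%N * sgn i I.
Proof.
rewrite /sgn; under eq_bigr => l _ do rewrite in_toggle signr_addb.
rewrite big_split /= mulrC; congr (_ * _); have [ji|ij] := ltnP j i.
  rewrite (bigD1 j) //= eqxx big1 ?mulr1 // => l /andP[_ /negPf ->].
  by rewrite expr0.
rewrite big1 // => l li; suff /negPf -> : l != j by rewrite expr0.
by apply: contraL li => /eqP ->; rewrite -leqNgt.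
Qed.

Lemma parity_toggle i I : parity (toggle i I) = - parity I.
Proof.
rewrite /parity; under eq_bigr => l _ do rewrite in_toggle signr_addb.
rewrite big_split /= mulrC (bigD1 i) //= eqxx big1 ?mulr1 ?mulN1r //.
by move=> l /negPf ->; rewrite expr0.
Qed.

Lemma sgn_sqr i I : sgn i I * sgn i I = 1.
Proof. by rewrite /sgn -big_split big1 //= => l _; rewrite -signr_addb addbb. Qed.

Lemma parity_sqr I : parity I * parity I = 1.
Proof. by rewrite /parity -big_split big1 //= => l _; rewrite -signr_addb addbb. Qed.

Lemma gradingK f : grading (grading f) = f.
Proof. by apply/ffunP => I; rewrite !ffunE mulrA parity_sqr mul1r. Qed.

Lemma gamma_grading u f : gamma u (grading f) = - grading (gamma u f).
Proof.
apply/ffunP => I; rewrite !ffunE -mulrN -sumrN mulr_sumr.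
apply: eq_bigr => j _; rewrite !ffunE parity_toggle.
by rewrite mulNr !mulrN mulrCA.
Qed.

(** Terms that toggle two different indices cancel, because exactly one of the two orders of
    toggling picks up an extra sign. Toggling the same index twice restores the set, and these terms
    form the scalar. *)
Lemma gamma_anticomm u v f :
  gamma u (gamma v f) + gamma v (gamma u f) =
  (\sum_j (u true j * v false j + u false j * v true j)) *: f.
Proof.
apply/ffunP => I; rewrite !ffunE.
have gammaE w w' : \sum_j w (j \in I) j * sgn j I * gamma w' f (toggle j I)
  = \sum_j \sum_l w (j \in I) j * sgn j I * (w' (l \in toggle j I) l
      * sgn l (toggle j I) * f (toggle l (toggle j I))).
  by apply: eq_bigr => j _; rewrite ffunE mulr_sumr.
rewrite !gammaE [X in _ + X]exchange_big -big_split [RHS]mulr_suml /=.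
apply: eq_bigr => j _; rewrite -big_split (bigD1 j) //= big1 ?addr0.
  rewrite !in_toggle !sgn_toggle toggleK ltnn expr0 mul1r eqxx addbT.
  rewrite !mulrA -mulrDl; congr (_ * _).
  have E (a b : k) : a * sgn j I * b * sgn j I = a * b.
    by rewrite -mulrA mulrACA sgn_sqr mulr1.
  rewrite !E; case: (j \in I) => /=; first by rewrite [v true j * _]mulrC.
  by rewrite addrC [v false j * _]mulrC.
move=> l lj; rewrite !in_toggle (negPf lj) eq_sym (negPf lj) !addbF.
rewrite !sgn_toggle (toggleC j).
have -> : (j < l)%N = ~~ (l < j)%N.
  by rewrite -leqNgt ltn_neqAle eq_sym (inj_eq val_inj) lj.
by rewrite signrN; ring.
Qed.

(** The contraction vanishes on all factors of x_I, and the exterior part is x_i alone, so a single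
    term survives. *)
Lemma gamma_delta u i I :
    (forall j, u true j = (j == i)%:R) -> (forall j, j \in I -> u false j = 0) ->
    i \notin I ->
  gamma u (delta I) = sgn i I *: delta (i |: I).
Proof.
move=> ut uf iI; apply/ffunP => J; rewrite !ffunE (bigD1 i) //= ffunE.
have toggleE j : (toggle j J == I) = (J == toggle j I).
  by rewrite -[X in _ = (X == _)](toggleK j) (inj_eq (can_inj (toggleK j))).
rewrite big1 ?addr0 => [|j ji]; last first.
  rewrite ffunE toggleE; case: eqP => [->|]; last by rewrite mulr0.
  rewrite in_toggle eqxx addbT; case jI: (j \in I) => /=.
    by rewrite uf // !mul0r.
  by rewrite ut (negPf ji) !mul0r.
have -> : i |: I = toggle i I.
  apply/setP => j; rewrite in_toggle !inE; have [->|] := eqVneq j i.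
    by rewrite (negPf iI).
  by rewrite addbF.
rewrite toggleE; case: eqP => [->|]; last by rewrite mulr0 scaler0.
rewrite in_toggle eqxx (negPf iI) ut eqxx sgn_toggle ltnn.
by rewrite !mul1r.
Qed.

End CliffordOperators.

(** * The relations as identities between operators *)

Section RelationShapes.
Variables (k : fieldType) (n : nat) (A : 'M[k]_n).

(* [clifford_GS] with an arbitrary dialgebra in place of the free one. *)
Variant clifford_rel (D : dialgebraType k) (g : 'I_n.+1 -> D) : D -> Prop :=
| Rel1 i j : clifford_rel g (g (xletter i) ⊢ g (xletter j)
    + g (xletter j) ⊣ g (xletter i) - (2%:R * A i j) *: g (eletter n))
| Rel2 y : clifford_rel g (g (eletter n) ⊢ g y - g y)
| Rel3 y : clifford_rel g (g y ⊣ g (eletter n) - g y)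
| Rel4 i j y : clifford_rel g (g y ⊣ g (xletter i) ⊣ g (xletter j)
    + g y ⊣ g (xletter j) ⊣ g (xletter i) - (2%:R * A i j) *: g y)
| Rel5 i y : clifford_rel g (g y ⊣ g (xletter i) ⊣ g (xletter i) - A i i *: g y)
| Rel6 i j y : clifford_rel g (g (xletter i) ⊢ g (xletter j) ⊢ g y
    + g (xletter j) ⊢ g (xletter i) ⊢ g y - (2%:R * A i j) *: g y)
| Rel7 i y : clifford_rel g (g (xletter i) ⊢ g (xletter i) ⊢ g y - A i i *: g y)
| Rel8 i : clifford_rel g (g (xletter i) ⊢ g (eletter n)
    - g (eletter n) ⊣ g (xletter i)).

(** The shapes of the left normed elements of S; see [GS_left_rel]. *)
Variant left_rel (D : dialgebraType k) (g : 'I_n.+1 -> D) : D -> Prop :=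
| LeftRel2 y : left_rel g (g (eletter n) ⊢ g y - g y)
| LeftRel6 i j y : left_rel g (g (xletter i) ⊢ g (xletter j) ⊢ g y
    + g (xletter j) ⊢ g (xletter i) ⊢ g y - (2%:R * A i j) *: g y)
| LeftRel7 i y : left_rel g (g (xletter i) ⊢ g (xletter i) ⊢ g y - A i i *: g y).

Lemma clifford_GS_rel s :
  clifford_GS A s -> clifford_rel (D := free_dialgebra k 'I_n.+1) (@dgen k _) s.
Proof.
by case=> [i j|y|y|i j y _|i y|i j y _|i y|i];
  [apply: Rel1|apply: Rel2|apply: Rel3|apply: Rel4|apply: Rel5|apply: Rel6
  |apply: Rel7|apply: Rel8].
Qed.

Definition clifford_ops (V : lmodType k) (G : 'I_n -> {linear V -> V}) : Prop :=
  (forall i j m, G i (G j m) + G j (G i m) = (2%:R * A i j) *: m) /\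
  (forall i m, G i (G i m) = A i i *: m).

Section Actions.
Variables (D : dialgebraType k) (g : 'I_n.+1 -> D) (V : lmodType k).
Implicit Types (a b s : D) (m : V) (i j : 'I_n).

Variables (L R : 'I_n -> {linear V -> V}) (lact ract : D -> {linear V -> V}).
Variables (eval : D -> V) (m0 : 'I_n.+1 -> V).
Hypotheses
  (lactB : forall a b m, lact (a - b) m = lact a m - lact b m)
  (lactD : forall a b m, lact (a + b) m = lact a m + lact b m)
  (lactZ : forall c a m, lact (c *: a) m = c *: lact a m)
  (lact_vdash : forall a b m, lact (a ⊢ b) m = lact a (lact b m))
  (lact_dashv : forall a b m, lact (a ⊣ b) m = lact a (lact b m))
  (lact_x : forall i m, lact (g (xletter i)) m = L i m)
  (lact_e : forall m, lact (g (eletter n)) m = m).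
Hypotheses
  (ractB : forall a b m, ract (a - b) m = ract a m - ract b m)
  (ractD : forall a b m, ract (a + b) m = ract a m + ract b m)
  (ractZ : forall c a m, ract (c *: a) m = c *: ract a m)
  (ract_vdash : forall a b m, ract (a ⊢ b) m = ract b (ract a m))
  (ract_dashv : forall a b m, ract (a ⊣ b) m = ract b (ract a m))
  (ract_x : forall i m, ract (g (xletter i)) m = R i m)
  (ract_e : forall m, ract (g (eletter n)) m = m).
Hypotheses
  (evalB : forall a b, eval (a - b) = eval a - eval b)
  (evalD : forall a b, eval (a + b) = eval a + eval b)
  (evalZ : forall c a, eval (c *: a) = c *: eval a)
  (eval_vdash : forall a b, eval (a ⊢ b) = lact a (eval b))
  (eval_dashv : forall a b, eval (a ⊣ b) = ract b (eval a))
  (eval_g : forall y, eval (g y) = m0 y).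
Hypotheses (Lops : clifford_ops L) (Rops : clifford_ops R).

Let lactE := (lactB, lactD, lactZ, lact_vdash, lact_dashv, lact_x, lact_e).
Let ractE := (ractB, ractD, ractZ, ract_vdash, ract_dashv, ract_x, ract_e).
Let evalE := (evalB, evalD, evalZ, eval_vdash, eval_dashv, eval_g,
  lact_vdash, lact_dashv, lact_x, lact_e, ract_vdash, ract_dashv, ract_x, ract_e).

Lemma lact_rel s m : clifford_rel g s -> lact s m = 0.
Proof.
have [LL L2] := Lops.
case=> [i j|y|y|i j y|i y|i j y|i y|i]; rewrite !lactE ?subrr //.
- by rewrite LL subrr.
- by rewrite -linearD LL linearZ subrr.
- by rewrite L2 linearZ subrr.
- by rewrite LL subrr.
- by rewrite L2 subrr.
Qed.

Lemma ract_rel s m : clifford_rel g s -> ract s m = 0.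
Proof.
have [RR R2] := Rops.
have RR' i j m' : R j (R i m') + R i (R j m') = (2%:R * A i j) *: m'.
  by rewrite addrC RR.
case=> [i j|y|y|i j y|i y|i j y|i y|i]; rewrite !ractE ?subrr //.
- by rewrite RR' subrr.
- by rewrite RR' subrr.
- by rewrite R2 subrr.
- by rewrite -linearD RR' linearZ subrr.
- by rewrite R2 linearZ subrr.
Qed.

(** Only relations 1 and 8 mix the two actions, whence the two conditions on [m0]; the others follow
    from the Clifford identities of one side and from e acting as the identity. *)
Lemma eval_rel s :
    (forall i j, L i (m0 (xletter j)) + R i (m0 (xletter j)) =
       (2%:R * A i j) *: m0 (eletter n)) ->
    (forall i, L i (m0 (eletter n)) = R i (m0 (eletter n))) ->
  clifford_rel g s -> eval s = 0.
Proof.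
have [[LL L2] [RR R2]] := (Lops, Rops) => evx eve.
case=> [i j|y|y|i j y|i y|i j y|i y|i]; rewrite !evalE ?subrr //.
- by rewrite evx subrr.
- by rewrite [X in X - _]addrC RR subrr.
- by rewrite R2 subrr.
- by rewrite LL subrr.
- by rewrite L2 subrr.
- by rewrite eve subrr.
Qed.

Lemma eval_left_rel s : left_rel g s -> eval s = 0.
Proof.
have [LL L2] := Lops; case=> [y|i j y|i y]; rewrite !evalE ?subrr //.
- by rewrite LL subrr.
- by rewrite L2 subrr.
Qed.

End Actions.
End RelationShapes.

Section LetterOperators.
Variables (k : fieldType) (n : nat) (A : 'M[k]_n) (V : lmodType k).
Implicit Types (i j : 'I_n) (m : V) (s : free_dialgebra k 'I_n.+1).

Definition letter_op (G : 'I_n -> {linear V -> V}) (z : 'I_n.+1) :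
    {linear V -> V} :=
  if unlift ord_max z is Some i then G i else idfun.

Lemma unlift_xletter i : unlift ord_max (xletter i) = Some i.
Proof.
have -> : xletter i = lift ord_max i by apply/val_inj/esym/lift_max.
exact: liftK.
Qed.

Lemma letter_op_x G i m : letter_op G (xletter i) m = G i m.
Proof. by rewrite /letter_op unlift_xletter. Qed.

Lemma letter_op_e G m : letter_op G (eletter n) m = m.
Proof. by rewrite /letter_op unlift_none. Qed.

Variables (L R : 'I_n -> {linear V -> V}) (m0 : 'I_n.+1 -> V).
Local Notation lactL := (lact (letter_op L)).
Local Notation ractR := (ract (letter_op R)).
Local Notation evalLR := (eval (letter_op L) (letter_op R) m0).

Lemma lact_GS s m : clifford_ops A L -> clifford_GS A s -> lactL s m = 0.
Proof.
move=> LL /clifford_GS_rel; apply: (lact_rel (L := L)) => //.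
- exact: lactB.
- exact: lactD.
- exact: lactZ.
- exact: lact_vdash.
- exact: lact_dashv.
- by move=> i m'; rewrite /= lact_gen letter_op_x.
- by move=> m'; rewrite /= lact_gen letter_op_e.
Qed.

Lemma ract_GS s m : clifford_ops A R -> clifford_GS A s -> ractR s m = 0.
Proof.
move=> RR /clifford_GS_rel; apply: (ract_rel (R := R)) => //.
- exact: ractB.
- exact: ractD.
- exact: ractZ.
- exact: ract_vdash.
- exact: ract_dashv.
- by move=> i m'; rewrite /= ract_gen letter_op_x.
- by move=> m'; rewrite /= ract_gen letter_op_e.
Qed.

Lemma eval_GS s : clifford_ops A L -> clifford_ops A R ->
    (forall y z m, letter_op L y (letter_op R z m) =
                   letter_op R z (letter_op L y m)) ->
    (forall i j, L i (m0 (xletter j)) + R i (m0 (xletter j)) =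
       (2%:R * A i j) *: m0 (eletter n)) ->
    (forall i, L i (m0 (eletter n)) = R i (m0 (eletter n))) ->
  clifford_GS A s -> evalLR s = 0.
Proof.
move=> LL RR LR m0x m0e /clifford_GS_rel.
apply: (eval_rel (L := L) (R := R) (m0 := m0) (lact := lactL) (ract := ractR)) => //.
- exact: lact_vdash.
- by move=> i m'; rewrite /= lact_gen letter_op_x.
- by move=> m'; rewrite /= lact_gen letter_op_e.
- by move=> i m'; rewrite /= ract_gen letter_op_x.
- by move=> m'; rewrite /= ract_gen letter_op_e.
- exact: evalB.
- exact: evalD.
- exact: evalZ.
- exact: eval_vdash.
- exact: eval_dashv.
- exact: eval_gen.
Qed.

Lemma left_rel_eval R' s : clifford_ops A L ->
  left_rel A (D := free_dialgebra k 'I_n.+1) (@dgen k _) s ->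
  eval (letter_op L) R' m0 s = 0.
Proof.
move=> LL; apply: (eval_left_rel (L := L) (m0 := m0) (lact := lactL)) => //.
- exact: lact_vdash.
- by move=> i m'; rewrite /= lact_gen letter_op_x.
- by move=> m'; rewrite /= lact_gen letter_op_e.
- exact: evalB.
- exact: evalD.
- exact: evalZ.
- exact: eval_vdash.
- exact: eval_gen.
Qed.

End LetterOperators.

(** * Left and right multiplication in the Clifford algebra *)

Section CliffordModel.
Variables (k : fieldType) (n : nat) (A : 'M[k]_n).
Hypothesis (char_k : 2%N \notin [pchar k]) (A_sym : A^T = A).
Implicit Types (i j l : 'I_n).
Notation W := {ffun {set 'I_n} -> k^o}.
Implicit Types (f : W).

Let two_neq0 : 2%:R != 0 :> k.
Proof. by apply: contra char_k => two0; rewrite inE /= two0. Qed.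

Let AC i j : A i j = A j i.
Proof. by rewrite -{1}A_sym mxE. Qed.

(** A triangular matrix whose sum with its transpose is 2A; its diagonal is therefore that of A, not
    of 2A. *)
Definition lower i j : k :=
  if (j < i)%N then 2%:R * A i j else if j == i then A i i else 0.

Lemma lowerD i j : lower i j + lower j i = 2%:R * A i j.
Proof.
rewrite /lower (eq_sym i j) (AC j i) -!(inj_eq val_inj) /=.
case: ltngtP => [||/val_inj ->]; rewrite ?addr0 ?add0r //.
by rewrite -mulr2n mulr_natl.
Qed.

Definition left_symbol i (b : bool) j : k := if b then (j == i)%:R else lower i j.
Definition right_symbol i (b : bool) j : k :=
  if b then (j == i)%:R else - lower j i.

(* Left and right multiplication by x_i in the Clifford algebra: x_i only *)
(* has to move past the j < i (resp. j > i), whence the triangular form.  *)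
Definition cliffl i : {linear W -> W} := gamma (left_symbol i).
Definition cliffr i : {linear W -> W} := gamma (right_symbol i) \o @grading k n.

Let sum_delta i (F : 'I_n -> k) : \sum_j (j == i)%:R * F j = F i.
Proof.
rewrite (bigD1 i) //= eqxx mul1r big1 ?addr0 // => j /negPf ->.
by rewrite mul0r.
Qed.

Lemma clifford_ops_double (V : lmodType k) (G : 'I_n -> {linear V -> V}) :
  (forall i j m, G i (G j m) + G j (G i m) = (2%:R * A i j) *: m) ->
  clifford_ops A G.
Proof.
move=> GG; split=> // i m; apply: (scalerI two_neq0).
by rewrite scalerA -GG scaler_nat.
Qed.

Lemma cliffl_ops : clifford_ops A cliffl.
Proof.
apply: clifford_ops_double => i j f; rewrite /cliffl gamma_anticomm /=.
rewrite big_split /= sum_delta; under eq_bigr => l _ do rewrite mulrC.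
by rewrite sum_delta addrC lowerD.
Qed.

(** Moving the grading past [gamma] costs a sign, which cancels the sign in [right_symbol]. *)
Lemma cliffr_ops : clifford_ops A cliffr.
Proof.
apply: clifford_ops_double => i j f; rewrite /cliffr /=.
have E i' j' : gamma (right_symbol i') (grading (gamma (right_symbol j') (grading f)))
    = - gamma (right_symbol i') (gamma (right_symbol j') f).
  by rewrite (gamma_grading _ f) [grading (- _)]linearN /= gradingK linearN.
rewrite !E -opprD gamma_anticomm -scaleNr big_split /=; congr (_ *: _).
rewrite sum_delta; under eq_bigr => l _ do rewrite mulrC.
by rewrite sum_delta opprD !opprK lowerD.
Qed.

(** The left and right symbols are chosen so that their [gamma] operators anticommute, the scalar
    being [lower i j - lower i j]; the grading in [cliffr] turns this into commutation. *)
Lemma cliffl_cliffr i j f : cliffl i (cliffr j f) = cliffr j (cliffl i f).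
Proof.
rewrite /cliffl /cliffr /= -[grading (gamma _ _)]opprK -gamma_grading linearN.
apply/eqP; rewrite -subr_eq0 opprK gamma_anticomm big_split /= sum_delta.
under eq_bigr => l _ do rewrite mulrC.
by rewrite sum_delta addNr scale0r.
Qed.

(** Putting x_i in front of an increasing product keeps it increasing, so nothing has to be
    reordered: the triangular contraction vanishes and the sign is 1. In [cliffr_delta] the sign
    equals the parity of I and cancels against the grading. *)
Lemma cliffl_delta i (I : {set 'I_n}) : (forall j, j \in I -> (i < j)%N) ->
  cliffl i (delta k I) = delta k (i |: I).
Proof.
move=> iI; rewrite /cliffl /= (@gamma_delta _ _ _ i) //.
- rewrite /sgn big1 ?scale1r // => l li; suff /negPf -> : l \notin I by [].
  by apply/negP => /iI; rewrite ltnNge ltnW.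
- by move=> j /iI ij; rewrite /= /lower ltnNge ltnW //= -(inj_eq val_inj) /= gtn_eqF.
by apply/negP => /iI; rewrite ltnn.
Qed.

Lemma cliffr_delta i (I : {set 'I_n}) : (forall j, j \in I -> (j < i)%N) ->
  cliffr i (delta k I) = delta k (i |: I).
Proof.
move=> Ii; rewrite /cliffr /=.
have -> : grading (delta k I) = parity k I *: delta k I.
  by apply/ffunP => J; rewrite !ffunE; case: eqP => [->|_]; rewrite ?mulr0 ?scaler0.
rewrite linearZ /= (@gamma_delta _ _ _ i) //.
- rewrite scalerA; suff -> : sgn k i I = parity k I by rewrite parity_sqr scale1r.
  rewrite /sgn /parity [RHS](bigID (fun l => l < i)%N) /= [X in _ * X]big1 ?mulr1 //.
  move=> l li; suff /negPf -> : l \notin I by [].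
  by apply: contra li => /Ii.
- by move=> j /Ii ji; rewrite /= /lower ltnNge ltnW //= -(inj_eq val_inj) /= gtn_eqF // oppr0.
by apply/negP => /Ii; rewrite ltnn.
Qed.

End CliffordModel.

(** * The models *)

Section DialgebraModels.
Variables (k : fieldType) (n : nat) (A : 'M[k]_n).
Hypothesis (char_k : 2%N \notin [pchar k]) (A_sym : A^T = A).
Notation Z := 'I_n.+1.
Notation W := {ffun {set 'I_n} -> k^o}.
Notation M := {ffun Z -> W}.
Implicit Types (i j l : 'I_n) (y z : Z) (I J : {set 'I_n}) (m : M).
Implicit Types (F : {linear W -> W}) (s : free_dialgebra k Z).

Variant letter_spec : Z -> option 'I_n -> Type :=
| LetterX i : letter_spec (xletter i) (Some i)
| LetterE : letter_spec (eletter n) None.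

Lemma letterP y : letter_spec y (unlift ord_max y).
Proof.
case: unliftP => [i ->|->]; last exact: LetterE.
suff -> : lift ord_max i = xletter i by exact: LetterX.
by apply/val_inj/lift_max.
Qed.

Lemma xletter_inj : injective (@xletter n).
Proof. by move=> i j /(congr1 val) /= /val_inj. Qed.

Lemma xletter_neq_e i : (xletter i == eletter n) = false.
Proof. by rewrite -(inj_eq val_inj) /= ltn_eqF. Qed.

Definition pointwise F m : M := [ffun y => F (m y)].
Fact pointwise_is_linear F : linear (pointwise F).
Proof. by move=> c m m'; apply/ffunP => y; rewrite !ffunE linearP. Qed.
HB.instance Definition _ F :=
  GRing.isLinear.Build k M M *:%R (pointwise F) (pointwise_is_linear F).

(* The bimodule V ⊗ Cl, for V spanned by X ∪ {e}: the right action is the *)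
(* right multiplication of Cl, the left action is forced by relations 1   *)
(* and 8, namely                                                          *)
(*   x_i (x_j ⊗ w) = - x_j ⊗ x_i w + 2 a_ij e ⊗ w, x_i (e ⊗ w) = e ⊗ x_i w *)
Definition bimod_left i m : M :=
  [ffun y => if unlift ord_max y is Some _ then - cliffl A i (m y)
     else cliffl A i (m y) + \sum_j (2%:R * A i j) *: m (xletter j)].
Fact bimod_left_is_linear i : linear (bimod_left i).
Proof.
move=> c m m'; apply/ffunP => y; rewrite !ffunE.
case: letterP => [j|]; rewrite linearP; first by rewrite opprD scalerN.
rewrite scalerDr -addrACA; congr (_ + _).
rewrite scaler_sumr -big_split; apply: eq_bigr => j _ /=.
by rewrite !ffunE scalerDr !scalerA mulrC.
Qed.
HB.instance Definition _ i :=
  GRing.isLinear.Build k M M *:%R (bimod_left i) (bimod_left_is_linear i).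

Definition bimod_right i : {linear M -> M} := pointwise (cliffr A i).
Definition free_left i : {linear M -> M} := pointwise (cliffl A i).

Definition base y I : M := [ffun z => if z == y then delta k I else 0].

Lemma baseE y I z J : base y I z J = ((z == y) && (J == I))%:R.
Proof. by rewrite ffunE; case: eqP => _; rewrite ffunE. Qed.

Lemma pointwise_base F y I J :
  F (delta k I) = delta k J -> pointwise F (base y I) = base y J.
Proof.
move=> FI; apply/ffunP => z; rewrite !ffunE.
by case: eqP; rewrite ?linear0.
Qed.

Lemma bimod_right_base i y I : (forall j, j \in I -> (j < i)%N) ->
  bimod_right i (base y I) = base y (i |: I).
Proof. by move=> Ii; apply/pointwise_base/cliffr_delta. Qed.

Lemma free_left_base i y I : (forall j, j \in I -> (i < j)%N) ->
  free_left i (base y I) = base y (i |: I).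
Proof. by move=> iI; apply/pointwise_base/cliffl_delta. Qed.

Lemma pointwise_ops (G : 'I_n -> {linear W -> W}) :
  clifford_ops A G -> clifford_ops A (fun i => pointwise (G i)).
Proof.
by move=> [GG G2]; split=> [i j m|i m]; apply/ffunP => y; rewrite !ffunE.
Qed.

Lemma bimod_left_x i m j : bimod_left i m (xletter j) = - cliffl A i (m (xletter j)).
Proof. by rewrite ffunE unlift_xletter. Qed.
Lemma bimod_left_e i m : bimod_left i m (eletter n) =
  cliffl A i (m (eletter n)) + \sum_j (2%:R * A i j) *: m (xletter j).
Proof. by rewrite ffunE unlift_none. Qed.

(** On the e-component, the terms 2 a_jl x_i m(x_l) arise twice with opposite signs, since the left
    action carries a minus sign on the x_l-components. *)
Lemma bimod_left_ops : clifford_ops A bimod_left.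
Proof.
have [LL _] := cliffl_ops char_k A_sym.
apply: clifford_ops_double => // i j m; apply/ffunP => y; rewrite 2!ffunE.
case: (letterP y) => [l|].
  by rewrite !bimod_left_x !linearN /= !opprK LL ffunE.
rewrite !bimod_left_e !linearD /= [RHS]ffunE -LL.
rewrite addrACA [X in X + _]addrACA -[RHS]addr0 -addrA; congr (_ + _).
rewrite !linear_sum -!big_split big1 //= => l _.
rewrite !bimod_left_x !linearZ /= !scalerN.
by rewrite addrACA [X in _ + X]addrC addrACA subrr addNr addr0.
Qed.

Lemma bimod_right_ops : clifford_ops A bimod_right.
Proof. exact/pointwise_ops/cliffr_ops. Qed.

Lemma bimod_LR i j m : bimod_left i (bimod_right j m) = bimod_right j (bimod_left i m).
Proof.
apply/ffunP => y; rewrite !ffunE; case: letterP => [l|].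
  by rewrite linearN cliffl_cliffr.
rewrite linearD -cliffl_cliffr linear_sum; congr (_ + _).
by apply: eq_bigr => l _; rewrite linearZ ffunE.
Qed.

Lemma letter_op_comm (V : lmodType k) (G H : 'I_n -> {linear V -> V}) :
    (forall i j v, G i (H j v) = H j (G i v)) ->
  forall y z v, letter_op G y (letter_op H z v) = letter_op H z (letter_op G y v).
Proof.
by move=> GH y z v; rewrite /letter_op; case: unlift; case: unlift => /=.
Qed.

Definition bimod_eval := eval (letter_op bimod_left) (letter_op bimod_right) (base^~ set0).

HB.instance Definition _ := GRing.isLinear.Build k (free_dialgebra k Z) M *:%R
  bimod_eval (evalP _ _ _).

Lemma bimod_eval_Id s : Id (clifford_GS A) s -> bimod_eval s = 0.
Proof.
have LR := letter_op_comm bimod_LR.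
move=> Ids; have ideal_ann := annihilated_ideal (base^~ set0) LR.
suff ann_GS t : clifford_GS A t ->
    annihilated (letter_op bimod_left) (letter_op bimod_right) (base^~ set0) t.
  by have [_ _ s0] := Ids _ ideal_ann ann_GS; exact: s0.
move=> Ss; split=> [m|m|].
- exact: lact_GS bimod_left_ops Ss.
- exact: ract_GS bimod_right_ops Ss.
apply: eval_GS Ss => //; [exact: bimod_left_ops|exact: bimod_right_ops| |].
  (* Relation 1: on the x_j-component the two actions contribute - x_i and x_i, which leaves 2 a_ij
     on the e-component. *)
  move=> i j; rewrite bimod_right_base => [|l]; last by rewrite inE.
  apply/ffunP => z; rewrite !ffunE; case: letterP => [l|].
    rewrite (inj_eq xletter_inj) xletter_neq_e scaler0.
    case: eqP => _; last by rewrite linear0 oppr0 addr0.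
    by rewrite cliffl_delta ?addNr // => l'; rewrite inE.
  rewrite eqxx eq_sym xletter_neq_e linear0 add0r addr0 (bigD1 j) //=.
  rewrite ffunE eqxx big1 ?addr0 // => l lj.
  by rewrite ffunE (inj_eq xletter_inj) (negPf lj) scaler0.
(* Relation 8: both actions send e ⊗ 1 to e ⊗ x_i. *)
move=> i; rewrite bimod_right_base => [|l]; last by rewrite inE.
apply/ffunP => z; rewrite !ffunE; case: letterP => [l|].
  by rewrite xletter_neq_e linear0 oppr0.
rewrite eqxx cliffl_delta => [|l]; last by rewrite inE.
by rewrite big1 ?addr0 // => l _; rewrite ffunE xletter_neq_e scaler0.
Qed.

Definition zero_op z : {linear M -> M} := \0%R.

(* V ⊗ Cl with x_i (y ⊗ w) = y ⊗ x_i w and zero right action: it only     *)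
(* sees the left normed part of a polynomial.                             *)
Definition free_eval := eval (letter_op free_left) zero_op (base^~ set0).

HB.instance Definition _ := GRing.isLinear.Build k (free_dialgebra k Z) M *:%R
  free_eval (evalP _ _ _).

Let free_LR y z m : letter_op free_left y (zero_op z m) = zero_op z (letter_op free_left y m).
Proof. exact: linear0. Qed.

Lemma free_left_ops : clifford_ops A free_left.
Proof. exact/pointwise_ops/cliffl_ops. Qed.

(** One s at a time, because this model does not kill all of S: relation 1 evaluates to x_j ⊗ x_i -
    2 a_ij e ⊗ 1 up to sign of neither term, hence not to 0. *)
Lemma free_eval_ideal s f : clifford_GS A s -> free_eval s = 0 ->
  Id (fun t => t = s) f -> free_eval f = 0.
Proof.
move=> Ss s0 Idf.
have ideal_ann := annihilated_ideal (base^~ set0) free_LR.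
suff ann_s t : t = s -> annihilated (letter_op free_left) zero_op (base^~ set0) t.
  by have [_ _ f0] := Idf _ ideal_ann ann_s; exact: f0.
move=> ->; split=> // m; first exact: lact_GS free_left_ops Ss.
(* A diword has at least one letter, so the zero operator occurs in its right action. *)
rewrite /ract /linext big1 // => u _.
suff -> : rop zero_op (dword u) m = 0 by rewrite scaler0.
case E: (dword u) => [|z t']; last exact: (linear0 (rop zero_op t')).
by case: u E => [[[|? ?] ?] ?].
Qed.

(** On the left all of S acts by 0, so s may fail to be left normed here; this is the situation of
    right multiplication compositions. *)
Lemma free_eval_vdash s f : clifford_GS A s -> free_eval (s ⊢ f) = 0.
Proof.
by move=> Ss; rewrite /free_eval eval_vdash; apply: lact_GS free_left_ops Ss.
Qed.

Notation increasing := (sorted (fun i j => (i < j)%N)).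

Lemma increasing_cons i (t : seq 'I_n) : increasing (i :: t) ->
  increasing t /\ forall j, j \in t -> (i < j)%N.
Proof.
rewrite /= path_sortedE; last by move=> ? ? ?; apply: ltn_trans.
by move=> /andP[/allP].
Qed.

Lemma increasing_eq (t t' : seq 'I_n) :
  increasing t -> increasing t' -> [set i in t] = [set i in t'] -> t = t'.
Proof.
move=> st st' /setP tt'; apply: (irr_sorted_eq _ _ st st') => [? ? ?|?|i].
- exact: ltn_trans.
- exact: ltnn.
by have := tt' i; rewrite !inE.
Qed.

Lemma bimod_point y (t : seq 'I_n) : increasing t ->
  point (letter_op bimod_left) (letter_op bimod_right) (base^~ set0)
    ([::], y, map (@xletter n) t) = base y [set i in t].
Proof.
move=> inc_t; rewrite /point /dpre /dpost /dcenter /=.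
(* The induction needs an arbitrary set of letters already multiplied, all smaller than those of t;
   it starts from [set0]. *)
rewrite -[[set i in t]]set0U.
have : forall i j, i \in (set0 : {set 'I_n}) -> j \in t -> (i < j)%N.
  by move=> i j; rewrite inE.
elim: t set0 inc_t => [|i t IH] I inc_t It /=.
  by rewrite set_nil setU0.
have [inc_t' i_t] := increasing_cons inc_t.
rewrite letter_op_x bimod_right_base => [|j jI]; last first.
  by rewrite It // inE eqxx.
rewrite IH // => [|j l]; last first.
  rewrite !inE => /orP[/eqP ->|jI] lt; first exact: i_t.
  by rewrite It // inE lt orbT.
by rewrite set_cons [i |: I]setUC setUA.
Qed.

Lemma free_point y (t : seq 'I_n) : increasing t ->
  point (letter_op free_left) zero_op (base^~ set0)
    (map (@xletter n) t, y, [::]) = base y [set i in t].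
Proof.
rewrite /point /dpre /dpost /dcenter /=.
elim: t => [|i t IH]; first by rewrite set_nil.
move=> /increasing_cons[inc_t i_t] /=; rewrite IH // letter_op_x.
by rewrite free_left_base ?set_cons // => j; rewrite inE; apply: i_t.
Qed.

Lemma base_independent (K : choiceType) (b : K -> M) (c : K -> Z * {set 'I_n})
    (f : {malg k[K]}) :
    (forall p, p \in msupp f -> b p = base (c p).1 (c p).2) ->
    {in msupp f &, injective c} ->
  linext b f = 0 -> f = 0.
Proof.
move=> bc c_inj f0; apply/malgP => p; rewrite mcoeff0.
case: (msuppP f p) => // fp.
have := congr1 (fun m : M => m (c p).1 (c p).2) f0.
rewrite /linext !sum_ffunE (bigD1_seq p) ?fset_uniq //= !ffunE big1_seq.
  by rewrite addr0 bc // baseE !eqxx [_ *: _]mulr1.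
move=> q /andP[qp fq]; rewrite !ffunE bc // baseE.
case: andP => [[/eqP e1 /eqP e2]|_]; last exact: mulr0.
case/eqP: qp; apply: c_inj => //.
by move: e1 e2; case: (c p) (c q) => [? ?] [? ?] /= -> ->.
Qed.

End DialgebraModels.

(** * S-diwords and the deg-lex ordering *)

Section DialgebraContexts.
Variables (k : fieldType) (Z : Type) (D : dialgebraType k) (gen : Z -> D).
Local Notation fill := (fill (@vdash k D) (@dashv k D) gen).

Lemma fill_linear C c f g :
  fill C (c *: f + g) = c *: fill C f + fill C g.
Proof.
have dashv_iter (r : seq D) c' p q :
    foldl (@dashv k D) (c' *: p + q) r =
    c' *: foldl (@dashv k D) p r + foldl (@dashv k D) q r.
  by elim: r p q => //= y r IH p q; rewrite dashv_linearl IH.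
have vdash_iter (l : seq D) c' p q :
    foldr (@vdash k D) (c' *: p + q) l =
    c' *: foldr (@vdash k D) p l + foldr (@vdash k D) q l.
  by elim: l => //= y l ->; rewrite vdash_linearr.
case: C => [a b|a b z r|a z b r] /=; rewrite /expr.
- by rewrite vdash_iter dashv_iter.
- by rewrite !foldr_cat /= vdash_linearl vdash_iter dashv_iter.
- by rewrite !foldl_cat /= dashv_linearr dashv_iter.
Qed.

Lemma ideal_fill (I : D -> Prop) C f : is_ideal I -> I f -> I (fill C f).
Proof.
move=> [_ _ I_mul].
have dashv_iter (r : seq D) p : I p -> I (foldl (@dashv k D) p r).
  by elim: r p => //= y r IH p Ip; apply: IH; case: (I_mul p y Ip).
have vdash_iter (l : seq D) p : I p -> I (foldr (@vdash k D) p l).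
  by move=> Ip; elim: l => //= y l /(I_mul _ y)[].
case: C => [a b|a b z r|a z b r] If /=; rewrite /expr.
- exact/dashv_iter/vdash_iter.
- rewrite foldr_cat /=; apply/dashv_iter/vdash_iter.
  by case: (I_mul f (foldr (@vdash k D) (gen z) (map gen b)) If).
- rewrite foldl_cat /=; apply: dashv_iter.
  by set p := foldl _ _ _; case: (I_mul f p If).
Qed.

End DialgebraContexts.

Section Contexts.
Variables (k : fieldType) (Z : choiceType).
Notation D := (free_dialgebra k Z).
Implicit Types (C : context Z) (u v : diword Z) (f : D).

Lemma expr_letters (a b : seq Z) u :
  expr (@dvdash Z) (@ddashv Z) (map (@dletter Z) a) u (map (@dletter Z) b) =
  (a ++ dpre u, dcenter u, dpost u ++ b).
Proof.
case: u => [[p z] q]; rewrite /expr /dpre /dcenter /dpost /=.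
have -> : foldr (@dvdash Z) (p, z, q) (map (@dletter Z) a) = (a ++ p, z, q).
  by elim: a => //= y a ->.
elim: b q => [|y b IH] q /=; first by rewrite cats0.
by rewrite (_ : ddashv _ _ = (a ++ p, z, q ++ [:: y])) // IH -catA.
Qed.

Lemma fill_diwordE C u : fill_diword C u =
  match C with
  | HoleCenter a b => (a ++ dpre u, dcenter u, dpost u ++ b)
  | HoleLeft a b z c => (a ++ dword u ++ b, z, c)
  | HoleRight a z b c => (a, z, b ++ dword u ++ c)
  end.
Proof.
case: C => [a b|a b z c|a z b c]; rewrite /fill_diword /=.
- exact: expr_letters.
- rewrite /expr foldr_cat /= -/(expr _ _ _ _ _).
  have -> : foldr (@dvdash Z) (dletter z) (map (@dletter Z) b) = (b, z, [::]).
    by have := expr_letters b [::] (dletter z); rewrite /expr /= cats0.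
  by rewrite -/(expr _ _ _ _ _) expr_letters /dvdash /= -catA.
rewrite /expr foldl_cat /=.
have -> : foldl (@ddashv Z) (foldr (@dvdash Z) (dletter z) (map (@dletter Z) a))
    (map (@dletter Z) b) = (a, z, b).
  by have := expr_letters a b (dletter z); rewrite /expr /= cats0.
have /= := expr_letters [::] c (ddashv (a, z, b) u); rewrite /expr /= => ->.
by rewrite /ddashv /dpost /= -catA.
Qed.

Lemma fill_poly_linear C c f g :
  fill_poly C (c *: f + g) = c *: fill_poly C f + fill_poly C g.
Proof. exact: fill_linear. Qed.
HB.instance Definition _ C :=
  GRing.isLinear.Build k D D *:%R (fill_poly C) (fill_poly_linear C).

Lemma monomialE f : f = \sum_(u <- msupp f) f@_u *: dmono k u.
Proof.
rewrite {1}[f]monalgE; apply: eq_bigr => u _.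
by rewrite /dmono -scale_monalgU mulr1.
Qed.

Lemma fill_polyE C f :
  fill_poly C f = \sum_(u <- msupp f) f@_u *: dmono k (fill_diword C u).
Proof.
rewrite {1}[f]monomialE linear_sum; apply: eq_bigr => u _.
by rewrite linearZ /= fill_poly_monomial.
Qed.

Lemma ideal_fill_poly (I : D -> Prop) C f :
  is_ideal I -> I f -> I (fill_poly C f).
Proof. exact: ideal_fill. Qed.

End Contexts.

(** * Compatibility of the deg-lex ordering with one-hole contexts *)

Section Monotonicity.
Variables (k : fieldType) (d : Order.disp_t) (Z : orderType d).
Notation D := (free_dialgebra k Z).
Implicit Types (C : context Z) (u v w : diword Z) (f s : D).
Import Order.SeqLexiOrder.Exports.

Definition lexlt (s t : seq Z) : bool := ((s : seqlexi Z) < t)%O.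

Lemma dltE u v : dlt u v = (dsize u < dsize v)%N || (dsize u == dsize v) &&
  ((size (dpre u) < size (dpre v))%N || (size (dpre u) == size (dpre v)) &&
   lexlt (dword u) (dword v)).
Proof.
rewrite /dlt /wt /lexlt !Order.ProdLexiOrder.ltxi_pair !leEnat.
by case: ltngtP => //=; case: ltngtP.
Qed.

Lemma dle_eqVlt u v : dle u v = (u == v) || dlt u v.
Proof.
rewrite /dle /dlt le_eqVlt; congr (_ || _).
apply/eqP/eqP => [|-> //]; case: u v => [[a z] b] [[a' z'] b'].
rewrite /wt /dword /dpre /dcenter /dpost /= => -[_ sz] /eqP.
by rewrite eqseq_cat // => /andP[/eqP -> /eqP[-> ->]].
Qed.

Lemma dlt_trans : transitive (@dlt d Z).
Proof. by move=> u v w; apply: lt_trans. Qed.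
Lemma dlt_irr u : dlt u u = false.
Proof. exact: ltxx. Qed.
Lemma dle_lt_trans u v w : dle u v -> dlt v w -> dlt u w.
Proof. exact: le_lt_trans. Qed.
Lemma dltW u v : dlt u v -> dle u v.
Proof. exact: ltW. Qed.
Lemma dle_size u v : dle u v -> (dsize u <= dsize v)%N.
Proof.
rewrite dle_eqVlt dltE => /orP[/eqP -> //|/orP[/ltnW //|/andP[/eqP -> //]]].
Qed.

Lemma lexlt_catl (a s t : seq Z) : lexlt (a ++ s) (a ++ t) = lexlt s t.
Proof.
elim: a => //= x a IH.
by rewrite /lexlt Order.SeqLexiOrder.eqhead_ltxiE [LHS]IH.
Qed.

Lemma lexlt_catr (b s t : seq Z) : size s = size t ->
  lexlt s t -> lexlt (s ++ b) (t ++ b).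
Proof.
elim: s t => [|x s IH] [|y t] //= [sz].
rewrite /lexlt !Order.SeqLexiOrder.ltxi_cons => /andP[-> /implyP st] /=.
by apply/implyP => /st; apply: IH.
Qed.

Definition fits C u : Prop :=
  match C with
  | HoleCenter _ _ => True
  | HoleLeft _ _ _ _ => dpost u = [::]
  | HoleRight _ _ _ _ => dpre u = [::]
  end.

Lemma normal_fits C s u : normal_sdiword C s -> u \in msupp s -> fits C u.
Proof. by case: C => //= *; auto. Qed.

Lemma dsizeE u : dsize u = (size (dpre u) + (size (dpost u)).+1)%N.
Proof. by rewrite /dsize /dword size_cat. Qed.

(** With the hole off the center, the result no longer records the center of u, and a comparison
    decided by its position would be lost. [fits] pins that center to an end of the word, so that
    diwords of equal length are compared by their words alone. *)
Lemma fill_diword_mono C u v : fits C u -> fits C v -> dlt u v ->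
  dlt (fill_diword C u) (fill_diword C v).
Proof.
rewrite !dltE !fill_diwordE => fu fv uv.
case: C fu fv => [a b _ _|a b z c /= fu fv|a z b c /= fu fv].
- rewrite !dsizeE /dword /dpre /dcenter /dpost /= !size_cat.
  rewrite !ltn_add2l !eqn_add2l.
  have E w : (size a + size w.1.1 + (size w.2 + size b).+1 =
      size a + size b + dsize w)%N.
    by rewrite dsizeE /dpre /dpost; lia.
  rewrite !E ltn_add2l eqn_add2l.
  case/orP: uv => [-> //|/andP[/eqP sz /orP[lt|/andP[eqp lt]]]]; apply/orP; right.
    by rewrite sz eqxx lt.
  rewrite sz eqxx eqp /= -!catA !lexlt_catl -!cat_cons !catA.
  by rewrite lexlt_catr ?orbT.
- have E w : dsize (a ++ dword w ++ b, z, c) =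
      (size a + size b + (size c).+1 + dsize w)%N.
    by rewrite dsizeE /dpre /dpost /= !size_cat [dsize w]dsizeE /=; lia.
  have F w : size (dpre (a ++ dword w ++ b, z, c)) =
      (size a + size b + dsize w)%N.
    by rewrite /dpre /= !size_cat [dsize w]dsizeE /=; lia.
  rewrite !E !F !ltn_add2l !eqn_add2l.
  case/orP: uv => [-> //|/andP[/eqP sz]]; rewrite sz ltnn eqxx /=.
  have : dsize u = dsize v by [].
  rewrite !dsizeE fu fv => /eqP; rewrite eqn_add2r => /eqP szp.
  rewrite szp ltnn eqxx /= => lt.
  have G (w : seq Z) : dword (a ++ w ++ b, z, c) = a ++ w ++ b ++ z :: c.
    by rewrite /dword /dpre -!catA.
  by rewrite !G lexlt_catl lexlt_catr.
- have E w : dsize (a, z, b ++ dword w ++ c) =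
      (size a + size b + (size c).+1 + dsize w)%N.
    by rewrite dsizeE /dpre /dpost /= !size_cat [dsize w]dsizeE /=; lia.
  rewrite !E ![dpre (_, _, _)]/= !ltn_add2l !eqn_add2l ltnn eqxx /=.
  case/orP: uv => [-> //|/andP[/eqP sz]]; rewrite sz fu fv !ltnn !eqxx /= => lt.
  have G (w : seq Z) : dword (a, z, b ++ w ++ c) = (a ++ z :: b) ++ w ++ c.
    by rewrite /dword /dpre -!catA.
  by rewrite !G lexlt_catl lexlt_catr.
Qed.

End Monotonicity.

(** * Reduction by S-diwords *)

Section LinearCombinations.
Variables (k : fieldType) (V : lmodType k) (X : Type) (F : X -> V).
Variable Q : X -> Prop.
Implicit Types (h r : V).

Definition lincomb h : Prop := exists (N : nat) (al : 'I_N -> k) (x : 'I_N -> X),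
  (forall i, Q (x i)) /\ h = \sum_i al i *: F (x i).

Lemma lincombP c h h' : lincomb h -> lincomb h' -> lincomb (c *: h + h').
Proof.
move=> [N [al [x [xQ ->]]]] [N' [al' [x' [xQ' ->]]]].
pose glue T (G : 'I_N -> T) (G' : 'I_N' -> T) (i : 'I_(N + N')) :=
  match split i with inl j => G j | inr j => G' j end.
exists (N + N')%N, (glue _ (fun i => c * al i) al'), (glue _ x x').
split=> [i|]; first by rewrite /glue; case: split.
rewrite big_split_ord scaler_sumr; congr (_ + _); apply: eq_bigr => i _.
  by rewrite /glue (unsplitK (inl i)) scalerA.
by rewrite /glue (unsplitK (inr i)).
Qed.

Lemma subr_linear c h h' r r' :
  c *: h + h' - (c *: r + r') = c *: (h - r) + (h' - r').
Proof. by rewrite scalerBr opprD addrACA. Qed.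

End LinearCombinations.

Section Combinations.
Variables (k : fieldType) (d : Order.disp_t) (Z : orderType d).
Notation D := (free_dialgebra k Z).
Variables (S : D -> Prop).
Implicit Types (C : context Z) (u v w t : diword Z) (f g h s r : D).
Implicit Types (P K : context Z -> D -> Prop).

Lemma combination0 P : combination S P 0.
Proof.
exists 0, (fun=> 0), (fun=> HoleCenter [::] [::]), (fun=> 0).
by split=> [[]//|]; rewrite big_ord0.
Qed.

Lemma combination_fill P C s : S s -> P C s -> combination S P (fill_poly C s).
Proof.
exists 1, (fun=> 1), (fun=> C), (fun=> s); split=> //.
by rewrite big_ord1 scale1r.
Qed.

Lemma combinationP P c h h' : combination S P h -> combination S P h' ->
  combination S P (c *: h + h').
Proof.
have lincombE g : combination S P g <-> lincomb
    (fun p => fill_poly p.1 p.2) (fun p => S p.2 /\ P p.1 p.2) g.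
  split=> [[N [al [C [s [sP ->]]]]]|[N [al [x [xP ->]]]]].
    by exists N, al, (fun i => (C i, s i)).
  by exists N, al, (fun i => (x i).1), (fun i => (x i).2).
by rewrite !lincombE; apply: lincombP.
Qed.

Lemma combination_sub P K h : (forall C s, S s -> P C s -> K C s) ->
  combination S P h -> combination S K h.
Proof.
move=> PK [N [al [C [s [sP ->]]]]]; exists N, al, C, s; split=> // i.
by have [? ?] := sP i; split=> //; apply: PK.
Qed.

Lemma combination_kernel P (V : lmodType k) (F : {linear D -> V}) h :
  (forall C s, S s -> P C s -> F (fill_poly C s) = 0) ->
  combination S P h -> F h = 0.
Proof.
move=> FP [N [al [C [s [sP ->]]]]]; rewrite linear_sum big1 // => i _.
by have [? ?] := sP i; rewrite linearZ /= FP ?scaler0.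
Qed.

Definition supported (Q : diword Z -> Prop) f : Prop :=
  forall v, v \in msupp f -> Q v.

Lemma supportedP Q c f g : supported Q f -> supported Q g -> supported Q (c *: f + g).
Proof.
move=> Qf Qg v; have [/Qf //|nf] := boolP (v \in msupp f).
have [/Qg //|ng] := boolP (v \in msupp g).
by rewrite -mcoeff_neq0 mcoeffD mcoeffZ !mcoeff_outdom // mulr0 addr0 eqxx.
Qed.

Lemma supported0 Q : supported Q 0.
Proof. by move=> v; rewrite msupp0 in_fset0. Qed.

Definition top f u : Prop := f@_u = 1 /\ supported (fun v => v = u \/ dlt v u) f.

Lemma top_mem f u : top f u -> u \in msupp f.
Proof. by case=> fu _; rewrite -mcoeff_neq0 fu oner_neq0. Qed.

Lemma top_leading f u : top f u -> leading f u.
Proof.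
move=> tfu; split; first exact: top_mem; case: tfu => _ fu v /fu.
by rewrite dle_eqVlt => -[->|->]; rewrite ?eqxx ?orbT.
Qed.

Lemma leading_unique f u v : leading f u -> leading f v -> u = v.
Proof.
move=> [fu lu] [fv lv]; have := lu v fv; have := lv u fu.
rewrite !dle_eqVlt => /orP[/eqP //|uv] /orP[/eqP //|vu].
by have := dlt_trans uv vu; rewrite dlt_irr.
Qed.

Lemma mcoeff_fill_poly C f v :
  (fill_poly C f)@_v = \sum_(u <- msupp f) f@_u *+ (fill_diword C u == v).
Proof.
rewrite fill_polyE raddf_sum; apply: eq_bigr => u _.
by rewrite /= mcoeffZ /dmono mcoeffU mulrnAr mulr1.
Qed.

Lemma supported_fill C f (Q : diword Z -> Prop) :
  supported (fun u => Q (fill_diword C u)) f -> supported Q (fill_poly C f).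
Proof.
move=> fQ v; rewrite -mcoeff_neq0 mcoeff_fill_poly => nz.
have [u fu <-] : exists2 u, u \in msupp f & fill_diword C u = v.
  apply: contrapT => noex; case/eqP: nz; rewrite big1_seq // => u /andP[_ fu].
  by case: eqP => // uv; case: noex; exists u.
exact: fQ.
Qed.

Lemma top_fill C f u : top f u -> normal_sdiword C f ->
  top (fill_poly C f) (fill_diword C u).
Proof.
move=> tfu nCf; have fu := top_mem tfu; case: tfu => f1 ltu.
have lt_fill v : v \in msupp f -> v != u -> dlt (fill_diword C v) (fill_diword C u).
  move=> fv vu; apply: fill_diword_mono; [exact: normal_fits fv|exact: normal_fits fu|].
  by case: (ltu v fv) => // /eqP; rewrite (negPf vu).
split.
  rewrite mcoeff_fill_poly (bigD1_seq u) ?fset_uniq //= eqxx f1.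
  rewrite big1_seq ?addr0 // => v /andP[vu fv].
  by case: eqP (lt_fill v fv vu) => // ->; rewrite dlt_irr.
apply: supported_fill => v fv.
by have [->|vu] := eqVneq v u; [left|right; apply: lt_fill].
Qed.

Lemma top_sub f g w : top f w -> top g w -> supported (fun v => dlt v w) (f - g).
Proof.
move=> [f1 fw] [g1 gw] v; rewrite -mcoeff_neq0 mcoeffB => nz.
have vw : v <> w by move=> e; move: nz; rewrite e f1 g1 subrr eqxx.
have [/fw[]//|nf] := boolP (v \in msupp f).
have [/gw[]//|ng] := boolP (v \in msupp g).
by move: nz; rewrite !mcoeff_outdom // subrr eqxx.
Qed.

(** K selects the S-diwords allowed in the reduction, N the diwords among which it stays, and
    [bound] limits the leading diwords used. The instances are all normal S-diwords, the right
    normed ones and the left normed ones. *)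
Variables (K : context Z -> D -> Prop) (N irr bound : diword Z -> Prop).
Hypotheses (dlt_wf : well_founded (fun u v => dlt u v))
  (K_normal : forall C s, K C s -> normal_sdiword C s)
  (bound_down : forall u v, dle u v -> bound v -> bound u)
  (reducible : forall v, N v -> ~ irr v -> exists C s u,
    [/\ S s, K C s, top s u, fill_diword C u = v &
        supported (fun t => N (fill_diword C t)) s]).

Definition reduces h : Prop := exists2 r, supported irr r &
  combination S (fun C s => K C s /\
    exists2 u, leading s u & bound (fill_diword C u)) (h - r).

Lemma reducesP c h h' : reduces h -> reduces h' -> reduces (c *: h + h').
Proof.
move=> [r ir hr] [r' ir' hr']; exists (c *: r + r'); first exact: supportedP.
rewrite subr_linear; exact: combinationP.
Qed.

Lemma reduces0 : reduces 0.
Proof. by exists 0; [exact: supported0|rewrite subr0; exact: combination0]. Qed.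

Lemma reduces_sum (I : eqType) (l : seq I) (c : I -> k) (F : I -> D) :
  (forall i, i \in l -> reduces (F i)) -> reduces (\sum_(i <- l) c i *: F i).
Proof.
elim: l => [|i l IH] rF; first by rewrite big_nil; apply: reduces0.
rewrite big_cons; apply: reducesP; first by apply: rF; rewrite inE eqxx.
by apply: IH => j lj; apply: rF; rewrite inE lj orbT.
Qed.

(** Well-founded induction: subtracting the S-diword with leading diword v leaves diwords that are
    smaller by [fill_diword_mono], still in N and within the bound. *)
Lemma reduces_monomial v : N v -> bound v -> reduces (dmono k v).
Proof.
elim/(well_founded_ind dlt_wf): v => v IH Nv bv.
have [iv|niv] := pselect (irr v).
  exists (dmono k v); last by rewrite subrr; apply: combination0.
  by move=> u /(fsubsetP msuppU_le); rewrite in_fset1 => /eqP ->.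
have [C [s [u [Ss KCs tsu Cu Ns]]]] := reducible Nv niv.
have su := top_mem tsu; have s1 : s@_u = 1 by case: tsu.
have fillE : fill_poly C s = dmono k v +
    \sum_(t <- msupp s | t != u) s@_t *: dmono k (fill_diword C t).
  by rewrite fill_polyE (bigD1_seq u) ?fset_uniq //= Cu s1 scale1r.
have -> : dmono k v = (-1) *: (\sum_(t <- msupp s | t != u)
    s@_t *: dmono k (fill_diword C t)) + fill_poly C s.
  by rewrite fillE scaleN1r addrC addrK.
apply: reducesP; last first.
  exists 0; first exact: supported0.
  rewrite subr0; apply: combination_fill => //; split=> //.
  by exists u; [apply: top_leading | rewrite Cu].
rewrite -big_filter; apply: reduces_sum => t; rewrite mem_filter => /andP[tu st].
have lt_tv : dlt (fill_diword C t) v.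
  rewrite -Cu; apply: fill_diword_mono.
  - exact: normal_fits (K_normal KCs) st.
  - exact: normal_fits (K_normal KCs) su.
  by case: tsu => _ /(_ t st)[/eqP|//]; rewrite (negPf tu).
by apply: IH => //; [exact: Ns|apply: bound_down bv; apply: dltW].
Qed.

Lemma reducesI h : supported N h -> supported bound h -> reduces h.
Proof.
move=> Nh bh; rewrite [h]monomialE; apply: reduces_sum => v hv.
by apply: reduces_monomial; [exact: Nh|exact: bh].
Qed.

(** The irreducible remainder has the same image as h under F, namely 0, and F is injective on
    irreducible combinations. *)
Lemma reduces_to_zero (V : lmodType k) (F : {linear D -> V}) h :
    (forall C s, S s -> K C s -> F (fill_poly C s) = 0) ->
    (forall r, supported irr r -> F r = 0 -> r = 0) ->
    supported N h -> supported bound h -> F h = 0 ->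
  combination S (fun C s => K C s /\
    exists2 u, leading s u & bound (fill_diword C u)) h.
Proof.
move=> FS F_inj Nh bh Fh; have [r ir hr] := reducesI Nh bh.
suff r0 : r = 0 by rewrite r0 subr0 in hr.
apply: F_inj => //; have : F (h - r) = 0.
  by apply: combination_kernel hr => C s Ss [KCs _]; apply: FS.
by rewrite linearB /= Fh sub0r => /eqP; rewrite oppr_eq0 => /eqP.
Qed.

End Combinations.

(** * Well-foundedness of the deg-lex ordering *)

Section WellFounded.
Variable n : nat.
Notation Z := 'I_n.+1.

(** The word read as a numeral in base n+1: among words of equal length the lexicographic order
    becomes the order of natural numbers. *)
Fixpoint value (s : seq Z) : nat :=
  if s is x :: t then (x * n.+1 ^ size t + value t)%N else 0%N.

Lemma value_lt s : (value s < n.+1 ^ size s)%N.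
Proof.
elim: s => [|x t IH] //=; rewrite expnS.
apply: (@leq_trans (x * n.+1 ^ size t + n.+1 ^ size t)); first by rewrite ltn_add2l.
by rewrite addnC -mulSn leq_mul2r ltn_ord orbT.
Qed.

Lemma lexlt_value (s t : seq Z) : size s = size t -> lexlt s t -> (value s < value t)%N.
Proof.
elim: s t => [|x s IH] [|y t] //= [sz].
rewrite /lexlt Order.SeqLexiOrder.ltxi_cons leEord => /andP[xy /implyP yx].
rewrite sz; move: xy; rewrite leq_eqVlt => /orP[/eqP e|lt].
  by rewrite e ltn_add2l IH //; apply: yx; rewrite e.
apply: (@leq_trans (x.+1 * n.+1 ^ size t)).
  by rewrite mulSn addnC ltn_add2r -sz value_lt.
by apply: leq_trans (leq_addr _ _); rewrite leq_mul2r lt orbT.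
Qed.

Lemma dlt_wf : well_founded (fun u v : diword Z => dlt u v).
Proof.
suff acc a b c u : dsize u = a -> size (dpre u) = b -> value (dword u) = c ->
    Acc (fun u v : diword Z => dlt u v) u.
  by move=> u; apply: acc.
elim/ltn_ind: a b c u => a IHa b; elim/ltn_ind: b => b IHb c.
elim/ltn_ind: c => c IHc u ua ub uc; constructor => v; rewrite dltE.
case/orP=> [lt|/andP[/eqP e /orP[lt|/andP[/eqP e' lt]]]].
- by apply: (IHa (dsize v)) => //; rewrite -ua.
- by apply: (IHb (size (dpre v))) => //; [rewrite -ub|rewrite e].
apply: (IHc (value (dword v))) => //; [|by rewrite e|by rewrite e'].
by rewrite -uc; apply: lexlt_value.
Qed.

End WellFounded.

(** * Leading diwords of the Clifford relations *)

Lemma mcoeff_sub (k : fieldType) (K : choiceType) (f h : {malg k[K]}) c w :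
  (f - c *: h)@_w = f@_w - c * h@_w.
Proof. by rewrite mcoeffB mcoeffZ. Qed.

Section LeadingDiwords.
Variables (k : fieldType) (n : nat) (A : 'M[k]_n).
Notation Z := 'I_n.+1.
Notation D := (free_dialgebra k Z).
Notation x := (@xletter n).
Notation e := (eletter n).
Notation gen := (@dgen k Z).
Implicit Types (i j : 'I_n) (y z : Z) (u v : diword Z) (s : D) (q p : seq Z).

Definition poly2 u (c : k) v : D := dmono k u - c *: dmono k v.
Definition poly3 u (t : diword Z) (c : k) v : D := dmono k u + dmono k t - c *: dmono k v.

(** S again, with monomials multiplied out and each element paired with its leading diword. *)
Variant GS_word : diword Z -> D -> Prop :=
| Word1 i j : let u := ([:: x i], x j, [::]) in
    GS_word u (poly3 u ([::], x j, [:: x i]) (2%:R * A i j) (dletter e))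
| Word2 y : let u := ([:: e], y, [::]) in GS_word u (poly2 u 1 (dletter y))
| Word3 y : let u := ([::], y, [:: e]) in GS_word u (poly2 u 1 (dletter y))
| Word4 i j y : (j < i)%N -> let u := ([::], y, [:: x i; x j]) in
    GS_word u (poly3 u ([::], y, [:: x j; x i]) (2%:R * A i j) (dletter y))
| Word5 i y : let u := ([::], y, [:: x i; x i]) in
    GS_word u (poly2 u (A i i) (dletter y))
| Word6 i j y : (j < i)%N -> let u := ([:: x i; x j], y, [::]) in
    GS_word u (poly3 u ([:: x j; x i], y, [::]) (2%:R * A i j) (dletter y))
| Word7 i y : let u := ([:: x i; x i], y, [::]) in
    GS_word u (poly2 u (A i i) (dletter y))
| Word8 i : let u := ([:: x i], e, [::]) in GS_word u (poly2 u 1 ([::], e, [:: x i])).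

Lemma gen_vdash y z : gen y ⊢ gen z = dmono k ([:: y], z, [::]).
Proof. exact: vdashU. Qed.
Lemma gen_dashv y z : gen y ⊣ gen z = dmono k ([::], y, [:: z]).
Proof. exact: dashvU. Qed.
Lemma gen_vdash3 y z z' : gen y ⊢ gen z ⊢ gen z' = dmono k ([:: y; z], z', [::]).
Proof.
by apply: etrans (f_equal (fun f : D => f ⊢ gen z') (gen_vdash y z)) _; apply: vdashU.
Qed.
Lemma gen_dashv3 y z z' : gen y ⊣ gen z ⊣ gen z' = dmono k ([::], y, [:: z; z']).
Proof.
by apply: etrans (f_equal (fun f : D => f ⊣ gen z') (gen_dashv y z)) _; apply: dashvU.
Qed.

Lemma poly2_eq (f : D) u c v : f = dmono k u -> f - c *: dmono k v = poly2 u c v.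
Proof. by move=> ->. Qed.
Lemma poly2_eq1 (f g : D) u v :
  f = dmono k u -> g = dmono k v -> f - g = poly2 u 1 v.
Proof. by move=> -> ->; rewrite /poly2 scale1r. Qed.
Lemma poly3_eq (f g : D) u (t : diword Z) c v : f = dmono k u -> g = dmono k t ->
  f + g - c *: dmono k v = poly3 u t c v.
Proof. by move=> -> ->. Qed.

Lemma clifford_GSE s : clifford_GS A s <-> exists u, GS_word u s.
Proof.
split=> [[i j|y|y|i j y ij|i y|i j y ij|i y|i]|[u []]].
- rewrite (poly3_eq _ _ (gen_vdash _ _) (gen_dashv _ _)).
  by exists ([:: x i], x j, [::]); apply: Word1.
- rewrite (poly2_eq1 (gen_vdash _ _) (erefl : gen y = dmono k (dletter y))).
  by exists ([:: e], y, [::]); apply: Word2.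
- rewrite (poly2_eq1 (gen_dashv _ _) (erefl : gen y = dmono k (dletter y))).
  by exists ([::], y, [:: e]); apply: Word3.
- rewrite (poly3_eq _ _ (gen_dashv3 _ _ _) (gen_dashv3 _ _ _)).
  by exists ([::], y, [:: x i; x j]); apply: Word4.
- rewrite (poly2_eq _ _ (gen_dashv3 _ _ _)).
  by exists ([::], y, [:: x i; x i]); apply: Word5.
- rewrite (poly3_eq _ _ (gen_vdash3 _ _ _) (gen_vdash3 _ _ _)).
  by exists ([:: x i; x j], y, [::]); apply: Word6.
- rewrite (poly2_eq _ _ (gen_vdash3 _ _ _)).
  by exists ([:: x i; x i], y, [::]); apply: Word7.
- rewrite (poly2_eq1 (gen_vdash _ _) (gen_dashv _ _)).
  by exists ([:: x i], e, [::]); apply: Word8.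
- move=> i j u'; rewrite -(poly3_eq _ _ (gen_vdash _ _) (gen_dashv _ _)).
  exact: CliffordGS1.
- move=> y u'; rewrite -(poly2_eq1 (gen_vdash _ _) (erefl : gen y = dmono k (dletter y))).
  exact: CliffordGS2.
- move=> y u'; rewrite -(poly2_eq1 (gen_dashv _ _) (erefl : gen y = dmono k (dletter y))).
  exact: CliffordGS3.
- move=> i j y ij u'; rewrite -(poly3_eq _ _ (gen_dashv3 _ _ _) (gen_dashv3 _ _ _)).
  exact: CliffordGS4.
- move=> i y u'; rewrite -(poly2_eq _ _ (gen_dashv3 _ _ _)).
  exact: CliffordGS5.
- move=> i j y ij u'; rewrite -(poly3_eq _ _ (gen_vdash3 _ _ _) (gen_vdash3 _ _ _)).
  exact: CliffordGS6.
- move=> i y u'; rewrite -(poly2_eq _ _ (gen_vdash3 _ _ _)).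
  exact: CliffordGS7.
- move=> i u'; rewrite -(poly2_eq1 (gen_vdash _ _) (gen_dashv _ _)).
  exact: CliffordGS8.
Qed.

Lemma dmono_coef u w : (dmono k u)@_w = (u == w)%:R.
Proof. exact: mcoeffU. Qed.
Lemma poly2_coef u c v w : (poly2 u c v)@_w = (u == w)%:R - c * (v == w)%:R.
Proof.
rewrite [LHS]mcoeff_sub; congr (_ - _ * _); exact: dmono_coef.
Qed.
Lemma poly3_coef u (t : diword Z) c v w :
  (poly3 u t c v)@_w = (u == w)%:R + (t == w)%:R - c * (v == w)%:R.
Proof.
rewrite [LHS]mcoeff_sub mcoeffD.
congr (_ + _ - _ * _); exact: dmono_coef.
Qed.

Lemma poly2_supported Q u c v : Q u -> Q v -> supported Q (poly2 u c v).
Proof.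
move=> Qu Qv w; rewrite -mcoeff_neq0 poly2_coef.
have [<- //|_] := eqVneq u w; have [<- //|_] := eqVneq v w.
by rewrite mulr0 subr0 eqxx.
Qed.
Lemma poly3_supported Q u (t : diword Z) c v : Q u -> Q t -> Q v -> supported Q (poly3 u t c v).
Proof.
move=> Qu Qt Qv w; rewrite -mcoeff_neq0 poly3_coef.
have [<- //|_] := eqVneq u w; have [<- //|_] := eqVneq t w.
have [<- //|_] := eqVneq v w.
by rewrite mulr0 addr0 subr0 eqxx.
Qed.

Lemma poly2_top u c v : dlt v u -> top (poly2 u c v) u.
Proof.
move=> vu; split; last by apply: poly2_supported; [left|right].
rewrite poly2_coef eqxx; case: eqP vu => [->|_ _]; first by rewrite dlt_irr.
by rewrite mulr0 subr0.
Qed.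
Lemma poly3_top u (t : diword Z) c v : dlt t u -> dlt v u -> top (poly3 u t c v) u.
Proof.
move=> tu vu; split; last by apply: poly3_supported; [left|right|right].
rewrite poly3_coef eqxx.
case: eqP tu => [->|_ _]; first by rewrite dlt_irr.
case: eqP vu => [->|_ _]; first by rewrite dlt_irr.
by rewrite mulr0 subr0 addr0.
Qed.

Lemma lexlt_head y z q p : (y < z)%N -> lexlt (y :: q) (z :: p).
Proof.
move=> yz; rewrite /lexlt Order.SeqLexiOrder.ltxi_cons leEord (ltnW yz) /=.
by rewrite leqNgt yz.
Qed.

Lemma GS_word_top u s : GS_word u s -> top s u.
Proof.
case=> [i j|y|y|i j y ij|i y|i j y ij|i y|i] u'.
- by apply: poly3_top; rewrite dltE.
- by apply: poly2_top; rewrite dltE.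
- by apply: poly2_top; rewrite dltE.
- apply: poly3_top; last by rewrite dltE.
  rewrite dltE /=.
  apply: etrans (lexlt_catl [:: y] [:: x j; x i] [:: x i; x j]) _.
  exact: lexlt_head.
- by apply: poly2_top; rewrite dltE.
- apply: poly3_top; last by rewrite dltE.
  by rewrite dltE /= /dword /=; apply: lexlt_head.
- by apply: poly2_top; rewrite dltE.
- by apply: poly2_top; rewrite dltE.
Qed.

Lemma GS_word_size u s : GS_word u s -> (1 < dsize u)%N.
Proof. by case. Qed.

Lemma GS_leading s u : clifford_GS A s -> leading s u -> GS_word u s.
Proof.
move=> /clifford_GSE[v sv] su.
by rewrite (leading_unique su (top_leading (GS_word_top sv))).
Qed.

(** The leading diword has at least two letters, so its center cannot be both first and last. Hence
    the right and left normed requirements on a composition never compete. *)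
Lemma GS_not_both s : clifford_GS A s -> right_normed s -> ~ left_normed s.
Proof.
move=> /clifford_GSE[u su] rs ls; have us := top_mem (GS_word_top su).
by have := GS_word_size su; rewrite dsizeE rs // ls.
Qed.

Lemma GS_left_rel s : clifford_GS A s -> left_normed s -> left_rel A gen s.
Proof.
move=> /clifford_GSE[u us] ls; have := ls _ (top_mem (GS_word_top us)).
case: us ls => [i j|y|y|i j y ij|i y|i j y ij|i y|i] u' ls //= _.
- have /ls // : ([::], x j, [:: x i]) \in msupp
      (poly3 u' ([::], x j, [:: x i]) (2%:R * A i j) (dletter e)).
  rewrite -mcoeff_neq0 poly3_coef eqxx.
  have /negPf -> : u' != ([::], x j, [:: x i]) by apply/eqP.
  have /negPf -> : dletter e != ([::], x j, [:: x i]) by apply/eqP.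
  by rewrite mulr0 subr0 add0r oner_neq0.
- rewrite -(poly2_eq1 (gen_vdash _ _) (erefl : gen y = dmono k (dletter y))).
  exact: LeftRel2.
- rewrite -(poly3_eq _ _ (gen_vdash3 _ _ _) (gen_vdash3 _ _ _)).
  exact: LeftRel6.
- rewrite -(poly2_eq _ _ (gen_vdash3 _ _ _)).
  exact: LeftRel7.
- have /ls // : ([::], e, [:: x i]) \in msupp (poly2 u' 1 ([::], e, [:: x i])).
  rewrite -mcoeff_neq0 poly2_coef eqxx.
  have /negPf -> : u' != ([::], e, [:: x i]) by apply/eqP.
  by rewrite mulr1 sub0r oppr_eq0 oner_neq0.
Qed.

(** * Irreducible diwords *)

Notation increasing := (sorted (fun i j : 'I_n => (i < j)%N)).

Definition right_irr v : Prop :=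
  exists y (t : seq 'I_n), increasing t /\ v = ([::], y, map x t).
Definition left_irr v : Prop :=
  exists y (t : seq 'I_n), increasing t /\ v = (map x t, y, [::]).

Variant bad_block : seq Z -> Prop :=
| BadE : bad_block [:: e]
| BadXX i j : (j <= i)%N -> bad_block [:: x i; x j].

Lemma increasing_or_bad q : (exists t : seq 'I_n, increasing t /\ q = map x t) \/
  exists p w p', bad_block w /\ q = p ++ w ++ p'.
Proof.
elim: q => [|z q [[t [inc_t ->]]|[p [w [p' [bw ->]]]]]].
- by left; exists [::].
- case: (letterP z) => [i|]; last first.
    by right; exists [::], [:: e], (map x t); split; first exact: BadE.
  case: t inc_t => [|j t] inc_t; first by left; exists [:: i].
  have [ji|ij] := leqP j i; last by left; exists (i :: j :: t); rewrite /= ij.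
  right; exists [::], [:: x i; x j], (map x t).
  by split; first exact: BadXX.
by right; exists (z :: p), w, p'.
Qed.

Lemma right_rule w y : bad_block w -> exists s,
  GS_word ([::], y, w) s /\ supported (fun v => dpre v = [::]) s.
Proof.
case=> [|i j ji].
  exists (poly2 ([::], y, [:: e]) 1 (dletter y)); split; first exact: Word3.
  exact: poly2_supported.
move: ji; rewrite leq_eqVlt => /orP[/eqP/val_inj ->|ji].
  exists (poly2 ([::], y, [:: x i; x i]) (A i i) (dletter y)); split.
    exact: Word5.
  exact: poly2_supported.
exists (poly3 ([::], y, [:: x i; x j]) ([::], y, [:: x j; x i])
  (2%:R * A i j) (dletter y)); split; first exact: Word4.
exact: poly3_supported.
Qed.

Lemma left_rule w y : bad_block w -> exists s,
  GS_word (w, y, [::]) s /\ supported (fun v => dpost v = [::]) s.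
Proof.
case=> [|i j ji].
  exists (poly2 ([:: e], y, [::]) 1 (dletter y)); split; first exact: Word2.
  exact: poly2_supported.
move: ji; rewrite leq_eqVlt => /orP[/eqP/val_inj ->|ji].
  exists (poly2 ([:: x i; x i], y, [::]) (A i i) (dletter y)); split.
    exact: Word7.
  exact: poly2_supported.
exists (poly3 ([:: x i; x j], y, [::]) ([:: x j; x i], y, [::])
  (2%:R * A i j) (dletter y)); split; first exact: Word6.
exact: poly3_supported.
Qed.

Lemma dword_fill C u :
  dword (fill_diword C u) = before_hole C ++ dword u ++ after_hole C.
Proof.
rewrite fill_diwordE; case: C => [a b|a b z c|a z b c] /=;
  by rewrite /dword /dpre /dcenter /dpost /= -?catA /= -?catA.
Qed.

Lemma right_dword_inj u v :
  dpre u = [::] -> dpre v = [::] -> dword u = dword v -> u = v.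
Proof.
by case: u v => [[a y] b] [[a' y'] b']; rewrite /dword /dpre /dcenter /dpost /=;
  move=> -> -> [-> ->].
Qed.

Lemma left_dword_inj u v :
  dpost u = [::] -> dpost v = [::] -> dword u = dword v -> u = v.
Proof.
case: u v => [[a y] b] [[a' y'] b']; rewrite /dword /dpre /dcenter /dpost /=.
move=> -> ->.
by rewrite !cats1 => /rcons_inj[-> ->].
Qed.

(** In a right normed diword the center is the first letter, so the hole is the center exactly when
    p is empty; dually for the last letter in [left_context]. *)
Definition right_context p q : context Z :=
  if p is z :: p' then HoleRight [::] z p' q else HoleCenter [::] q.
Definition left_context p q : context Z :=
  if rev q is z :: q' then HoleLeft p (rev q') z [::] else HoleCenter p [::].

Lemma right_context_dpre p q u :
  dpre u = [::] -> dpre (fill_diword (right_context p q) u) = [::].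
Proof. by rewrite fill_diwordE; case: p. Qed.

Lemma left_context_dpost p q u :
  dpost u = [::] -> dpost (fill_diword (left_context p q) u) = [::].
Proof.
by rewrite fill_diwordE /left_context; case: (rev q) => //=; rewrite cats0.
Qed.

Lemma dword_right_context p q u :
  dword (fill_diword (right_context p q) u) = p ++ dword u ++ q.
Proof. by rewrite dword_fill; case: p. Qed.

Lemma dword_left_context p q u :
  dword (fill_diword (left_context p q) u) = p ++ dword u ++ q.
Proof.
rewrite dword_fill /left_context; have := revK q.
by case: (rev q) => [|z q'] <- //=; rewrite rev_cons cats1.
Qed.

Lemma right_reducible v : dpre v = [::] -> ~ right_irr v -> exists C s u,
  [/\ clifford_GS A s, right_normed_sdiword C s, top s u, fill_diword C u = v &
      supported (fun t => dpre (fill_diword C t) = [::]) s].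
Proof.
case: v => [[a c] q] a0; rewrite (a0 : a = [::]) => {a a0} nirr.
have [[t [inc_t qt]]|[p [w [p' [bw qE]]]]] := increasing_or_bad q.
  by case: nirr; exists c, t; rewrite qt.
(* Relations 3, 4 and 5 include the letter y before the block, which is the center c itself when p
   is empty. *)
have [p0 [y pE]] : exists p0 y, c :: p = rcons p0 y.
  by exists (belast c p), (last c p); apply: lastI.
have [s [sw sN]] := right_rule y bw.
have fillN : supported (fun t => dpre (fill_diword (right_context p0 p') t) = [::]) s.
  by move=> t /sN; apply: right_context_dpre.
exists (right_context p0 p'), s, ([::], y, w); split=> //.
- by apply/clifford_GSE; exists ([::], y, w).
- split=> //; first by case: (p0).
  exact: supported_fill.
- exact: GS_word_top.
apply: right_dword_inj => //; first exact: right_context_dpre.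
rewrite dword_right_context qE.
by rewrite -[RHS]/((c :: p) ++ w ++ p') pE cat_rcons.
Qed.

Lemma left_reducible v : dpost v = [::] -> ~ left_irr v -> exists C s u,
  [/\ clifford_GS A s, left_normed_sdiword C s, top s u, fill_diword C u = v &
      supported (fun t => dpost (fill_diword C t) = [::]) s].
Proof.
case: v => [[q c] a] a0; rewrite (a0 : a = [::]) => {a a0} nirr.
have [[t [inc_t qt]]|[p [w [p' [bw qE]]]]] := increasing_or_bad q.
  by case: nirr; exists c, t; rewrite qt.
(* Relations 2, 6 and 7 include the letter y after the block, which is the center c itself when [p']
   is empty. *)
have [y [p0 pE]] : exists y p0, rcons p' c = y :: p0.
  by case: (p') => [|z r]; [exists c, [::]|exists z, (rcons r c)].
have [s [sw sN]] := left_rule y bw.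
have fillN : supported (fun t => dpost (fill_diword (left_context p p0) t) = [::]) s.
  by move=> t /sN; apply: left_context_dpost.
exists (left_context p p0), s, (w, y, [::]); split=> //.
- by apply/clifford_GSE; exists (w, y, [::]).
- split=> //; first by rewrite /left_context; case: (rev p0).
  exact: supported_fill.
- exact: GS_word_top.
apply: left_dword_inj => //; first exact: left_context_dpost.
rewrite dword_left_context qE.
rewrite -[RHS]/((p ++ w ++ p') ++ [:: c]) -!catA cats1 pE.
by [].
Qed.

(** If letters precede the center, the last of them and the center form the leading diword of
    relation 1, 2 or 8; otherwise v is right normed. *)
Lemma reducible v : ~ right_irr v -> exists C s u,
  [/\ clifford_GS A s, normal_sdiword C s, top s u, fill_diword C u = v &
      supported (fun=> True) s].
Proof.
case: v => [[q c] a]; case: (lastP q) => [|p z] nirr.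
  have [C [s [u [Ss [Cs _ _] su <- _]]]] := right_reducible (erefl : dpre ([::], c, a) = [::]) nirr.
  by exists C, s, u; split.
have [s sw] : exists s, GS_word ([:: z], c, [::]) s.
  case: (letterP z) => [i|]; last by eexists; apply: Word2.
  by case: (letterP c) => [j|]; eexists; [apply: Word1|apply: Word8].
exists (HoleCenter p a), s, ([:: z], c, [::]); split=> //.
- by apply/clifford_GSE; exists ([:: z], c, [::]).
- exact: GS_word_top.
by rewrite fill_diwordE cats1.
Qed.

End LeadingDiwords.

(** * The derived relations *)

Section DialgebraLinearity.
Variables (k : fieldType) (D : dialgebraType k).
Implicit Types (a b c : D).

Lemma vdashDl a b c : (a + b) ⊢ c = a ⊢ c + b ⊢ c.
Proof. by have := vdash_linearl 1 a b c; rewrite !scale1r. Qed.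
Lemma vdashDr a b c : a ⊢ (b + c) = a ⊢ b + a ⊢ c.
Proof. by have := vdash_linearr 1 a b c; rewrite !scale1r. Qed.
Lemma dashvDl a b c : (a + b) ⊣ c = a ⊣ c + b ⊣ c.
Proof. by have := dashv_linearl 1 a b c; rewrite !scale1r. Qed.
Lemma dashvDr a b c : a ⊣ (b + c) = a ⊣ b + a ⊣ c.
Proof. by have := dashv_linearr 1 a b c; rewrite !scale1r. Qed.
Lemma vdash0l a : 0 ⊢ a = 0.
Proof. by apply: (addrI (0 ⊢ a)); rewrite -vdashDl !addr0. Qed.
Lemma vdash0r a : a ⊢ 0 = 0.
Proof. by apply: (addrI (a ⊢ 0)); rewrite -vdashDr !addr0. Qed.
Lemma dashv0l a : 0 ⊣ a = 0.
Proof. by apply: (addrI (0 ⊣ a)); rewrite -dashvDl !addr0. Qed.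
Lemma dashv0r a : a ⊣ 0 = 0.
Proof. by apply: (addrI (a ⊣ 0)); rewrite -dashvDr !addr0. Qed.
Lemma vdashZl t a b : (t *: a) ⊢ b = t *: (a ⊢ b).
Proof. by have := vdash_linearl t a 0 b; rewrite vdash0l !addr0. Qed.
Lemma vdashZr t a b : a ⊢ (t *: b) = t *: (a ⊢ b).
Proof. by have := vdash_linearr t a b 0; rewrite vdash0r !addr0. Qed.
Lemma dashvZl t a b : (t *: a) ⊣ b = t *: (a ⊣ b).
Proof. by have := dashv_linearl t a 0 b; rewrite dashv0l !addr0. Qed.
Lemma dashvZr t a b : a ⊣ (t *: b) = t *: (a ⊣ b).
Proof. by have := dashv_linearr t a b 0; rewrite dashv0r !addr0. Qed.

End DialgebraLinearity.

Section DerivedRelations.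
Variables (k : fieldType) (n : nat) (A : 'M[k]_n) (D : dialgebraType k).
Variable g : 'I_n.+1 -> D.
Hypotheses (char_k : 2%N \notin [pchar k]) (A_neq0 : A != 0).
Implicit Types (i j p q : 'I_n) (y : 'I_n.+1).
Local Notation x i := (g (xletter i)).
Local Notation e := (g (eletter n)).
Hypothesis rel1 : forall i j, x i ⊢ x j + x j ⊣ x i = (2%:R * A i j) *: e.
Hypothesis rel2 : forall y, e ⊢ g y = g y.
Hypothesis rel3 : forall y, g y ⊣ e = g y.

Let two_neq0 : 2%:R != 0 :> k.
Proof. by apply: contra char_k => two0; rewrite inE /= two0. Qed.

(** Relation 1 multiplied by [g y ⊣], behind which the two products agree. *)
Lemma derived4 i j y :
  g y ⊣ x i ⊣ x j + g y ⊣ x j ⊣ x i = (2%:R * A i j) *: g y.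
Proof.
by rewrite -dashv_vdash -[g y ⊣ x j ⊣ x i]dashvA -dashvDr rel1 dashvZr rel3.
Qed.

Lemma derived6 i j y :
  x i ⊢ x j ⊢ g y + x j ⊢ x i ⊢ g y = (2%:R * A i j) *: g y.
Proof. by rewrite -[x j ⊢ x i ⊢ g y]vdash_dashv -vdashDl rel1 vdashZl rel2. Qed.

(* d_i = x_i ⊢ e - e ⊣ x_i satisfies a_pq d_i = - a_iq d_p: expand        *)
(* x_i ⊢ r - r ⊣ x_i for r = x_p ⊢ x_q + x_q ⊣ x_p = 2 a_pq e.            *)
Lemma derived8_aux i p q :
  (2%:R * A p q) *: (x i ⊢ e - e ⊣ x i) = - ((2%:R * A i q) *: (x p ⊢ e - e ⊣ x p)).
Proof.
have e1 : x i ⊢ (x q ⊣ x p) = (2%:R * A i q) *: (e ⊣ x p) - x q ⊣ x i ⊣ x p.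
  by rewrite vdash_dashvA -dashvZl -rel1 dashvDl addrK.
have e2 : x p ⊢ x q ⊣ x i = (2%:R * A i q) *: (x p ⊢ e) - x p ⊢ x i ⊢ x q.
  by rewrite -vdash_dashvA -vdashZr -rel1 vdashDr -vdashA addrC addKr.
have shuffle (V : zmodType) (a b c d u v : V) :
    a + (u - c) - ((v - b) + d) = (a + b) - (c + d) + (u - v).
  by rewrite !opprD !opprK !addrA [LHS](ACl (1*5*3*6*2*4))%AC.
rewrite scalerBr -vdashZr -dashvZl -rel1 vdashDr dashvDl.
rewrite e1 e2 vdashA shuffle derived6 derived4.
by rewrite subrr add0r -scalerBr -scalerN opprB.
Qed.

(** Take a_pq nonzero. [derived8_aux] with i = p gives a_pq d_p = - a_pq d_p, so d_p = 0; for
    general i it then gives a_pq d_i = 0. *)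
Lemma derived8 i : x i ⊢ e = e ⊣ x i.
Proof.
have /matrix0Pn[p [q Apq]] := A_neq0.
have nz : 2%:R * A p q != 0 by rewrite mulf_neq0.
have dp : x p ⊢ e - e ⊣ x p = 0.
  apply: (scalerI nz); rewrite scaler0; apply: (scalerI two_neq0).
  by rewrite scaler0 scaler_nat mulr2n {2}derived8_aux subrr.
apply/eqP; rewrite -subr_eq0; apply/eqP/(scalerI nz).
by rewrite derived8_aux dp !scaler0 oppr0.
Qed.

Lemma derived_rel s : clifford_rel A g s -> s = 0.
Proof.
case=> [i j|y|y|i j y|i y|i j y|i y|i].
- by rewrite rel1 subrr.
- by rewrite rel2 subrr.
- by rewrite rel3 subrr.
- by rewrite derived4 subrr.
- apply/eqP; rewrite subr_eq0; apply/eqP/(scalerI two_neq0).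
  by rewrite scalerA -derived4 scaler_nat.
- by rewrite derived6 subrr.
- apply/eqP; rewrite subr_eq0; apply/eqP/(scalerI two_neq0).
  by rewrite scalerA -derived6 scaler_nat.
- by rewrite derived8 subrr.
Qed.

End DerivedRelations.

Section Morphism.
Variables (k : fieldType) (n : nat) (A : 'M[k]_n) (D E : dialgebraType k).
Variables (g : 'I_n.+1 -> D) (phi : {linear D -> E}).
Hypotheses (phi_vdash : forall a b, phi (a ⊢ b) = phi a ⊢ phi b)
  (phi_dashv : forall a b, phi (a ⊣ b) = phi a ⊣ phi b).
Hypotheses (char_k : 2%N \notin [pchar k]) (A_neq0 : A != 0).
Local Notation x i := (g (xletter i)).
Local Notation e := (g (eletter n)).

(** The relations are derived among the images of the generators, as in D itself the first three
    need not hold; the case of interest is the projection to the quotient. *)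
Lemma derived_rel_morph s :
    (forall i j, phi (x i ⊢ x j + x j ⊣ x i - (2%:R * A i j) *: e) = 0) ->
    (forall y, phi (e ⊢ g y - g y) = 0) -> (forall y, phi (g y ⊣ e - g y) = 0) ->
  clifford_rel A g s -> phi s = 0.
Proof.
have phiE := (linearB phi, linearD phi, linearZ_LR phi, phi_vdash, phi_dashv).
move=> r1 r2 r3 gs.
apply: (@derived_rel _ _ A _ (fun y => phi (g y))) => // [i j|y|y|].
- by apply/eqP; rewrite -subr_eq0 -(r1 i j) !phiE.
- by apply/eqP; rewrite -subr_eq0 -(r2 y) !phiE.
- by apply/eqP; rewrite -subr_eq0 -(r3 y) !phiE.
case: gs => [i j|y|y|i j y|i y|i j y|i y|i]; rewrite !phiE;
  [exact: (Rel1 A (fun y => phi (g y)))|exact: (Rel2 A (fun y => phi (g y)))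
  |exact: (Rel3 A (fun y => phi (g y)))|exact: (Rel4 A (fun y => phi (g y)))
  |exact: (Rel5 A (fun y => phi (g y)))|exact: (Rel6 A (fun y => phi (g y)))
  |exact: (Rel7 A (fun y => phi (g y)))|exact: (Rel8 A (fun y => phi (g y)))].
Qed.

End Morphism.

(** * The Clifford dialgebra *)

Section CliffordQuotient.
Variables (k : fieldType) (n : nat) (A : 'M[k]_n).
Hypotheses (char_k : 2%N \notin [pchar k]) (A_sym : A^T = A) (A_neq0 : A != 0).
Notation Z := 'I_n.+1.
Notation D := (free_dialgebra k Z).
Notation x := (@xletter n).
Notation GS := (@clifford_GS k n A).
Notation Rel := (@clifford_relation k n A).
Notation pi := (quot_pi Rel).
Notation increasing := (sorted (fun i j : 'I_n => (i < j)%N)).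
Implicit Types (f h r s : D) (C : context Z) (u v w : diword Z).

Fact quot_pi_linear c f g : pi (c *: f + g) = c *: pi f + pi g.
Proof. by rewrite quot_piD quot_piZ. Qed.
HB.instance Definition _ := GRing.isLinear.Build k D (clifford A) *:%R
  (pi : D -> clifford A) quot_pi_linear.

Lemma Id_mem (S : D -> Prop) s : S s -> Id S s.
Proof. by move=> Ss I _; apply. Qed.

Lemma Rel_pi f : pi f = 0 <-> Id Rel f.
Proof. by rewrite -(linear0 pi) quot_piP subr0. Qed.

Lemma GS_pi s : GS s -> pi s = 0.
Proof.
move=> /clifford_GS_rel.
apply: (@derived_rel_morph k n A _ (clifford A) (@dgen k Z) pi
  (@quot_pi_vdash _ _ _) (@quot_pi_dashv _ _ _) char_k A_neq0).
- by move=> i j; apply/Rel_pi; apply: Id_mem; exact: (CliffordRel A i j).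
- by move=> y; apply/Rel_pi; apply: Id_mem; exact: (CliffordBarL A y).
- by move=> y; apply/Rel_pi; apply: Id_mem; exact: (CliffordBarR A y).
Qed.

Lemma Rel_GS s : Rel s -> GS s.
Proof.
by case=> [i j|y|y]; [exact: CliffordGS1|exact: CliffordGS2|exact: CliffordGS3].
Qed.

Lemma Id_GS_Rel f : Id GS f <-> Id Rel f.
Proof.
split=> [/(_ _ (Id_ideal Rel))|/(_ _ (Id_ideal GS))]; apply.
  by move=> s /GS_pi/Rel_pi.
by move=> s /Rel_GS/Id_mem.
Qed.

Lemma Id_fill (S : D -> Prop) C s : S s -> Id S (fill_poly C s).
Proof. by move=> Ss; exact: (ideal_fill_poly C (Id_ideal S) (Id_mem Ss)). Qed.

Lemma combination_Id P h : combination GS P h -> Id GS h.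
Proof.
have [I0 IP _] := Id_ideal GS; move=> [N [al [C [s [sP ->]]]]].
elim/big_rec: _ => [//|i g _ Ig]; apply: IP => //.
by have [Ss _] := sP i; exact: Id_fill.
Qed.

Lemma bimod_eval_fill C s : GS s -> bimod_eval A (fill_poly C s) = 0.
Proof. by move=> Ss; apply: (bimod_eval_Id char_k A_sym); apply: Id_fill. Qed.

Lemma in_map_x (t : seq 'I_n) : [set i | x i \in map x t] = [set i in t].
Proof. by apply/setP => i; rewrite !inE (mem_map (@xletter_inj n)). Qed.

Lemma right_irr_independent r :
  supported (@right_irr n) r -> bimod_eval A r = 0 -> r = 0.
Proof.
move=> ir; apply: (base_independent
  (c := fun u => (dcenter u, [set i | x i \in dpost u]))).
  move=> u /ir[y [t [inc_t ->]]]; rewrite /dcenter /dpost /= in_map_x.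
  exact: bimod_point.
move=> u v /ir[y [t [inc_t ->]]] /ir[y' [t' [inc_t' ->]]].
rewrite /dcenter /dpost /= !in_map_x => -[-> tt'].
by rewrite (increasing_eq inc_t inc_t' tt').
Qed.

Lemma left_irr_independent r :
  supported (@left_irr n) r -> free_eval A r = 0 -> r = 0.
Proof.
move=> ir; apply: (base_independent
  (c := fun u => (dcenter u, [set i | x i \in dpre u]))).
  move=> u /ir[y [t [inc_t ->]]]; rewrite /dcenter /dpre /= in_map_x.
  exact: free_point.
move=> u v /ir[y [t [inc_t ->]]] /ir[y' [t' [inc_t' ->]]].
rewrite /dcenter /dpre /= !in_map_x => -[-> tt'].
by rewrite (increasing_eq inc_t inc_t' tt').
Qed.

Lemma free_eval_fill C s : GS s -> left_normed s -> free_eval A (fill_poly C s) = 0.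
Proof.
move=> Ss ls; apply: (free_eval_ideal char_k A_sym Ss).
  apply: left_rel_eval; first exact: free_left_ops.
  exact: GS_left_rel.
exact: (@Id_fill (fun t => t = s)).
Qed.

Lemma right_combination bound h :
    (forall u v, dle u v -> bound v -> bound u) ->
    supported (fun v => dpre v = [::]) h -> supported bound h ->
    bimod_eval A h = 0 ->
  combination GS (fun C s => right_normed_sdiword C s /\
    exists2 u, leading s u & bound (fill_diword C u)) h.
Proof.
move=> down; apply: (reduces_to_zero (@dlt_wf n) _ down _ (F := bimod_eval A)).
- by move=> C s [].
- exact: right_reducible.
- by move=> C s Ss _; apply: bimod_eval_fill.
- exact: right_irr_independent.
Qed.

Lemma left_combination bound h :
    (forall u v, dle u v -> bound v -> bound u) ->
    supported (fun v => dpost v = [::]) h -> supported bound h ->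
    free_eval A h = 0 ->
  combination GS (fun C s => left_normed_sdiword C s /\
    exists2 u, leading s u & bound (fill_diword C u)) h.
Proof.
move=> down; apply: (reduces_to_zero (@dlt_wf n) _ down _ (F := free_eval A)).
- by move=> C s [].
- exact: left_reducible.
- by move=> C s Ss [_ ls _]; apply: free_eval_fill.
- exact: left_irr_independent.
Qed.

Lemma normal_combination bound h :
    (forall u v, dle u v -> bound v -> bound u) -> supported bound h ->
    bimod_eval A h = 0 ->
  combination GS (fun C s => normal_sdiword C s /\
    exists2 u, leading s u & bound (fill_diword C u)) h.
Proof.
move=> down bh; apply: (reduces_to_zero (N := fun=> True) (irr := @right_irr n)
  (@dlt_wf n) _ down _ (F := bimod_eval A)) => //.
- by move=> v _; apply: reducible.
- by move=> C s Ss _; apply: bimod_eval_fill.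
- exact: right_irr_independent.
Qed.

(** Bounding by the leading diword itself is stronger than the bound on lengths that triviality
    requires; for h = 0 it is void. *)
Let below h v := forall w, leading h w -> dle v w.

Let below_down h u v : dle u v -> below h v -> below h u.
Proof. by move=> uv hv w /hv; apply: le_trans. Qed.

Let below_supported h : supported (below h) h.
Proof. by move=> v hv w [_]; apply. Qed.

(** z ⊣ f is right normed whatever f is, and it lies in the ideal. *)
Lemma GS_left_mult : left_mult_trivial GS.
Proof.
move=> f z Sf _; pose C := HoleRight [::] z [::] [::] : context Z.
have h0 := bimod_eval_fill C Sf.
have Nh : supported (fun v => dpre v = [::]) (fill_poly C f).
  by apply: supported_fill => u _; rewrite fill_diwordE.
apply: combination_sub (right_combination (@below_down _) Nh (@below_supported _) h0).
move=> C' s Ss [rCs [u su bu]]; split=> //; exists u => // w /bu.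
exact: dle_size.
Qed.

Lemma GS_right_mult : right_mult_trivial GS.
Proof.
move=> f z Sf _; pose C := HoleLeft [::] [::] z [::] : context Z.
have h0 : free_eval A (fill_poly C f) = 0.
  exact: (free_eval_vdash char_k A_sym (dgen k z) Sf).
have Nh : supported (fun v => dpost v = [::]) (fill_poly C f).
  by apply: supported_fill => u _; rewrite fill_diwordE.
apply: combination_sub (left_combination (@below_down _) Nh (@below_supported _) h0).
move=> C' s Ss [lCs [u su bu]]; split=> //; exists u => // w /bu.
exact: dle_size.
Qed.

(** Inclusion and intersection at once: both S-diwords are monic with leading diword w, so their
    difference has only smaller diwords. The three cases differ in which S-diwords may be used and
    hence in the model. *)
Lemma GS_trivial_mod f g Cf Cg u v w (rn ln : Prop) :
    GS f -> GS g -> leading f u -> leading g v ->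
    normal_sdiword Cf f -> normal_sdiword Cg g ->
    w = fill_diword Cf u -> w = fill_diword Cg v ->
    (rn -> right_normed_sdiword Cf f /\ right_normed_sdiword Cg g) ->
    (ln -> left_normed_sdiword Cf f /\ left_normed_sdiword Cg g) ->
  trivial_mod GS w rn ln (fill_poly Cf f - fill_poly Cg g).
Proof.
move=> Sf Sg fu gv nf ng wf wg rnP lnP; set h := _ - _.
have tf := top_fill (GS_word_top (GS_leading Sf fu)) nf.
have tg := top_fill (GS_word_top (GS_leading Sg gv)) ng.
rewrite -wf in tf; rewrite -wg in tg.
have bh : supported (fun t => dlt t w) h by exact: top_sub.
have down u' v' : dle u' v' -> dlt v' w -> dlt u' w by apply: dle_lt_trans.
have subE Q : supported Q (fill_poly Cf f) -> supported Q (fill_poly Cg g) ->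
    supported Q h.
  by move=> Qf Qg; rewrite /h addrC -scaleN1r; apply: supportedP.
have h0 : bimod_eval A h = 0.
  by rewrite [LHS]linearB /= !bimod_eval_fill ?subr0.
have [rnT|rnF] := pselect rn.
  have [[_ rf rCf] [_ rg rCg]] := rnP rnT.
  apply: combination_sub (right_combination down (subE _ rCf rCg) bh h0).
  move=> C s Ss [rCs lt]; split=> //; first by case: rCs.
  by move=> /lnP[[_ lf _] _]; case: (GS_not_both Sf rf).
have [lnT|lnF] := pselect ln.
  have [[_ lf lCf] [_ lg lCg]] := lnP lnT.
  have h0' : free_eval A h = 0.
    by rewrite [LHS]linearB /= !free_eval_fill ?subr0.
  apply: combination_sub (left_combination down (subE _ lCf lCg) bh h0').
  by move=> C s Ss [lCs lt]; split=> //; case: lCs.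
apply: combination_sub (normal_combination down bh h0).
by move=> C s Ss [nCs lt]; split.
Qed.

Lemma GS_inclusion : inclusion_trivial GS.
Proof.
move=> f g C u v Sf Sg fu gv ng uv.
(* The trivial context presents f itself as an S-diword. *)
pose C0 := HoleCenter [::] [::] : context Z.
apply: (@GS_trivial_mod f g C0 C u v) => //.
- by move=> [rf rg].
- by move=> [lf lg].
Qed.

Lemma GS_intersection : intersection_trivial GS.
Proof.
move=> f g Cf Cg u v w Sf Sg fu gv _ _ nf ng wf wg _.
exact: (GS_trivial_mod Sf Sg fu gv nf ng wf wg).
Qed.

Lemma clifford_GS_basis : is_GS_basis GS.
Proof.
split; [|exact: GS_left_mult|exact: GS_right_mult|exact: GS_inclusion
  |exact: GS_intersection].
move=> s /clifford_GSE[u /GS_word_top su]; exists u; first exact: top_leading.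
by case: su.
Qed.

Notation Idx := (Z * increasing_seq n)%type.

Definition increasing_diword (p : Idx) : diword Z :=
  ([::], p.1, map x (val p.2)).

Lemma clifford_monomialE p :
  clifford_monomial A p = pi (dmono k (increasing_diword p)).
Proof.
rewrite diwordE /clifford_monomial /expr /= -[map x _]/(map x _) -map_comp.
rewrite /clifford_gen; elim: (val p.2) (dgen k p.1) => //= i t IH f.
by rewrite -[_ ⊣ _]quot_pi_dashv IH.
Qed.

(** A vanishing combination lifts to an element of Id(S), which the model kills while sending the
    monomials involved to distinct basis vectors. *)
Lemma clifford_monomial_free (c : {malg k[Idx]}) :
  linext (clifford_monomial A) c = 0 -> c = 0.
Proof.
pose f : D := linext (fun p => dmono k (increasing_diword p)) c.
have -> : linext (clifford_monomial A) c = pi f.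
  by rewrite /f /linext linear_sum; apply: eq_bigr => p _; rewrite linearZ clifford_monomialE.
move=> /Rel_pi/Id_GS_Rel/(bimod_eval_Id char_k A_sym) f0.
apply: (base_independent (c := fun p : Idx =>
  (p.1, [set i in val p.2])) (b := fun p => bimod_eval A (dmono k (increasing_diword p)))).
- move=> p _; rewrite [LHS]evalU; apply: bimod_point; exact: (valP p.2).
- move=> [y [t inc_t]] [y' [t' inc_t']] _ _ [/= -> tt'].
  by congr (_, _); apply: val_inj; apply: increasing_eq tt'.
- rewrite -[RHS]f0 /f /linext [RHS]linear_sum; apply: eq_bigr => p _.
  by rewrite [RHS]linearZ.
Qed.

(** Reduction with no bound: a representative is congruent to a combination of irreducible
    diwords. *)
Lemma clifford_monomial_span (v : clifford A) :
  exists c : {malg k[Idx]}, v = linext (clifford_monomial A) c.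
Proof.
rewrite -[v]quot_reprK; set f : D := repr v.
have [r ir /combination_Id/Id_GS_Rel/quot_piP ->] :
    reduces GS (fun C s => normal_sdiword C s) (@right_irr n) (fun=> True) f.
  by apply: (reducesI (N := fun=> True) (@dlt_wf n)) => // u _; apply: reducible.
rewrite [r]monomialE linear_sum big_seq.
elim/big_rec: _ => [|u y ru [c ->]]; first by exists 0; rewrite linear0.
have [z [t [inc_t uE]]] := ir u ru.
exists (r@_u *: << (z, Sub t inc_t) >> + c).
rewrite [RHS]linearP linearZ /= linextU scale1r clifford_monomialE.
by rewrite (_ : increasing_diword _ = u) // uE.
Qed.

End CliffordQuotient.

Theorem theorem4p10 (k : fieldType) (n : nat) (A : 'M[k]_n)
    (char_k : 2%N \notin [pchar k]) (A_sym : A^T = A) (A_neq0 : A != 0) :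
  (is_GS_basis (@clifford_GS k n A) /\
   forall f : free_dialgebra k 'I_n.+1,
     Id (@clifford_GS k n A) f <-> Id (@clifford_relation k n A) f)
  /\ linear_basis (@clifford_monomial k n A).
Proof.
split; last first.
  split; first exact: clifford_monomial_free.
  exact: clifford_monomial_span.
by split; [exact: clifford_GS_basis|exact: Id_GS_Rel].
Qed.
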